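(* Let $p$ be a prime number and let $\mathbb{F}$ be a finite field of characteristic $p$. For every integer $n \geq 5$, there exist a global function field $k$ over $\mathbb{F}$ and an unramified geometric Galois extension $K/k$ such that $\mathrm{Gal}(K/k) \cong \mathfrak{S}_n$, the symmetric group of degree $n$.
   Context: A global function field over $\mathbb{F}$ is a function field of one variable over the finite field $\mathbb{F}$ (with constant field $\mathbb{F}$). An extension $K/k$ of global function fields is geometric if the constant field of $K$ equals that of $k$ (i.e. no constant field extension occurs). ''Unramified'' means unramified at every place of $k$. *)

(* Defs.v *)
From HB Require Import structures.
From mathcomp Require Import all_boot all_order all_algebra all_fingroup all_field.
From mathcomp Require Import fraction.
Set Implicit Arguments. Unset Strict Implicit. Unset Printing Implicit Defensive.
Import Order.TTheory GRing.Theory Num.Theory.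
Local Open Scope ring_scope.

Definition ratfun (F : fieldType) : fieldType := {fraction {poly F}}.

Definition constF (F : fieldType) (L : fieldExtType (ratfun F)) (c : F) : L :=
  (@FracField.tofrac {poly F} (c%:P))%:A.

Definition constant_field_is_F (F : fieldType) (L : fieldExtType (ratfun F))
  (E : {vspace L}) : Prop :=
  forall y : L, y \in E ->
    (exists q : {poly F}, q != 0 /\ root (map_poly (@constF F L) q) y) ->
    exists c : F, y = constF L c.

(* Normalized discrete valuation w of the field E (given as a subfield of L),
   trivial on the constants F: w : E^x ->> Z multiplicative, ultrametric,
   surjective, w(c) = 0 for c in F^x.  (Values of w outside E^x are irrelevant.) *)
Definition is_normalized_dval (F : fieldType) (L : fieldExtType (ratfun F))
  (E : {vspace L}) (w : L -> int) : Prop :=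
  [/\ forall x y, x \in E -> y \in E -> x != 0 -> y != 0 -> w (x * y) = w x + w y,
      forall x y, x \in E -> y \in E -> x != 0 -> y != 0 -> x + y != 0 ->
        Num.min (w x) (w y) <= w (x + y),
      exists2 t, t \in E & (t != 0) && (w t == 1)
    & forall c : F, c != 0 -> w (constF L c) = 0].

(* K/k is unramified at every place of k: every place Q of K (a normalized
   discrete valuation w_Q of K trivial on F) has ramification index 1 over its
   restriction to k, i.e. w_Q restricted to k^x is still surjective onto Z.
   (Residue field extensions of finite fields are automatically separable.) *)
Definition unramified (F : fieldType) (L : fieldExtType (ratfun F))
  (k K : {vspace L}) : Prop :=
  forall w : L -> int, is_normalized_dval K w ->
    exists2 a, a \in k & (a != 0) && (w a == 1).

(* Main.v *)
Require Import Defs.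
From HB Require Import structures.
From mathcomp Require Import all_boot all_order all_algebra all_fingroup all_field.
From mathcomp Require Import fraction generic_quotient mpoly zify ring.
From Stdlib Require Import Classical ClassicalEpsilon.
Set Implicit Arguments. Unset Strict Implicit. Unset Printing Implicit Defensive.
Import Order.TTheory GRing.Theory Num.Theory.
Local Open Scope ring_scope.

(** Let L be the splitting field over F(t) of f = g - t h, where g/h is a rational
    function of large prime degree m whose fibres contain a bounded number of
    non-simple points, and where 0 is a double zero of g, alone in its fibre. The inertia
    at t = 0 contains a transposition, so Gal(L / F(t)) is S_m; inertia acts trivially on
    constants and the transpositions generate S_m, so L has constant field F. Embed S_n
    diagonally in S_m, as r copies of its natural action: a nontrivial element moves at
    least r roots of f. At each place the roots that are not simple modulo the place are
    fewer than r, hence the simple ones generate L over the fixed field k of S_n, and a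
    simple root generates an unramified extension. *)

(** * Polynomials with coefficients in a subring *)

(** The bound on non-simple points must not grow with [m], because [r] has to exceed it while [m]
    has to hold [n * r] points. A separable function of degree [m] has a different of degree 2m - 2,
    so with tame ramification alone no such bound exists. In characteristic p nearly all of the
    different can sit at one wildly ramified point: [g / h] has a pole of order divisible by p at
    infinity, and [wronskian g h] has degree at most p. The field may be as small as F_2, so no
    parameter can be put in general position, and [g] and [h] are explicit. Taking [m] prime
    replaces a proof of primitivity: a transitive group of prime degree containing a transposition
    is the full symmetric group. Two notions of place occur. Ramification over k concerns a given
    valuation of L, and only residue classes modulo its maximal ideal are needed. Inertia at t = 0
    needs a place to exist; there a homomorphism on a finitely generated ring of integral elements
    suffices, and it comes from symmetric polynomials. *)

Section SubringPolynomials.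

Variable R : fieldType.
Implicit Types (S M : R -> Prop) (P Q D : {poly R}).

Definition is_subring S :=
  [/\ S 1, forall x y, S x -> S y -> S (x - y)
    & forall x y, S x -> S y -> S (x * y)].

Definition is_ideal S M :=
  [/\ M 0, forall x y, M x -> M y -> M (x - y)
    & forall x y, S x -> M y -> M (x * y)].

Definition coefs_in M P := forall i, M P`_i.

(** Lets each closure lemma for an ideal [M] serve for the subring itself, with [M := S]. *)
Lemma subring_ideal S : is_subring S -> is_ideal S S.
Proof. by case=> S1 SB SM; split=> //; rewrite -(subrr 1); apply: SB. Qed.

Section Ideal.

Variables S M : R -> Prop.
Hypotheses (ringS : is_subring S) (idM : is_ideal S M).

Lemma ideal_opp x : M x -> M (- x).
Proof. by case: idM => M0 MB _ Mx; rewrite -sub0r; apply: MB. Qed.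

Lemma ideal_add x y : M x -> M y -> M (x + y).
Proof.
by case: (idM) => _ MB _ Mx My; rewrite -[y]opprK; apply/MB/ideal_opp.
Qed.

Lemma ideal_sum (I : Type) (r : seq I) (A : pred I) (F : I -> R) :
  (forall i, A i -> M (F i)) -> M (\sum_(i <- r | A i) F i).
Proof.
by move=> MF; elim/big_ind: _ => //; [case: idM | apply: ideal_add].
Qed.

Lemma subring_exp x n : S x -> S (x ^+ n).
Proof.
by case: ringS => S1 _ SM Sx; elim: n => // n IHn; rewrite exprS; apply: SM.
Qed.

Lemma subring_prod (I : Type) (r : seq I) (A : pred I) (F : I -> R) :
  (forall i, A i -> S (F i)) -> S (\prod_(i <- r | A i) F i).
Proof. by move=> SF; elim/big_ind: _ => //; case: ringS. Qed.

Lemma coefs_in0 : coefs_in M 0.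
Proof. by move=> i; rewrite coef0; case: idM. Qed.

Lemma coefs_inC c : M c -> coefs_in M c%:P.
Proof. by move=> Mc i; rewrite coefC; case: ifP => // _; case: idM. Qed.

Lemma coefs_inB P Q : coefs_in M P -> coefs_in M Q -> coefs_in M (P - Q).
Proof. by move=> MP MQ i; rewrite coefB; case: idM => _ MB _; apply: MB. Qed.

Lemma coefs_inD P Q : coefs_in M P -> coefs_in M Q -> coefs_in M (P + Q).
Proof. by move=> MP MQ i; rewrite coefD; apply: ideal_add. Qed.

Lemma coefs_inM P Q : coefs_in S P -> coefs_in M Q -> coefs_in M (P * Q).
Proof.
by move=> SP MQ i; rewrite coefM; apply: ideal_sum => j _; case: idM => _ _; apply.
Qed.

Lemma coefs_in_deriv P : coefs_in M P -> coefs_in M P^`().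
Proof.
move=> MP i; rewrite coef_deriv.
elim: {2}i.+1 => [|n IHn]; first by rewrite mulr0n; case: idM.
by rewrite mulrSr; apply: ideal_add.
Qed.

Lemma coefs_in_horner P x : coefs_in M P -> S x -> M P.[x].
Proof.
move=> MP Sx; rewrite horner_coef; apply: ideal_sum => i _.
by rewrite mulrC; case: idM => _ _; apply=> //; apply: subring_exp.
Qed.

(** Long division from the top: as [D] is monic, the highest coefficient of [Q] is a coefficient of
    [Q * D], and subtracting its term shortens [Q]. Only indices from the degree of [D] on are
    tested, so a remainder of smaller degree does not interfere. *)
Lemma coefs_in_monic_factor D Q : D \is monic -> coefs_in S D ->
  (forall i, ((size D).-1 <= i)%N -> M (Q * D)`_i) -> coefs_in M Q.
Proof.
move=> monD SD; move: {2}(size Q) (leqnn (size Q)) => n.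
elim: n Q => [|n IHn] Q.
  by rewrite leqn0 size_poly_eq0 => /eqP-> _; apply: coefs_in0.
move=> szQ MQD; set d := (size D).-1 in MQD.
have DQ : Q = Q`_n *: 'X^n + take_poly n Q.
  apply/polyP=> i; rewrite coefD coefZ coefXn coef_take_poly.
  case: ltngtP => [_|lt_ni|->]; rewrite ?mulr0 ?add0r ?mulr1 ?addr0 //.
  by rewrite nth_default ?(leq_trans szQ).
have Dd : D`_d = 1 by rewrite -lead_coefE (monicP monD).
have MQn : M Q`_n.
  have := MQD (n + d)%N (leq_addl _ _).
  rewrite {1}DQ mulrDl coefD -scalerAl coefZ coefXnM ltnNge leq_addr /= addKn Dd.
  rewrite mulr1 [X in _ + X]nth_default ?addr0 //.
  apply: leq_trans (size_polyMleq _ _) _.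
  have := size_take_poly n Q; rewrite /d; have := size_poly_gt0 D.
  by rewrite monic_neq0 //; move: (size D) (size (take_poly n Q)) => a b; lia.
rewrite DQ; apply: coefs_inD.
  move=> i; rewrite coefZ coefXn; case: eqP => _; rewrite ?mulr1 ?mulr0 //.
  by case: idM.
apply: IHn => [|i le_di]; first exact: size_take_poly.
have -> : take_poly n Q = Q - Q`_n *: 'X^n by rewrite {2}DQ addrC addKr.
rewrite mulrBl coefB; case: (idM) => _ MB MM; apply: MB; first exact: MQD.
rewrite -scalerAl coefZ coefXnM; case: ifP => _; first by rewrite mulr0; case: idM.
by rewrite mulrC; apply: MM.
Qed.

(** Modulo [M], [P] is a multiple of a monic polynomial of larger degree, so the quotient [Q], and
    with it [P], vanishes modulo [M]. *)
Lemma coefs_in_small_mod D Q P : D \is monic -> coefs_in S D ->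
  coefs_in S Q -> coefs_in M (P - Q * D) -> (size P < size D)%N -> coefs_in M P.
Proof.
move=> monD SD SQ MPQD ltPD; rewrite -[P](subrK (Q * D)).
apply: coefs_inD => //; rewrite mulrC; apply: coefs_inM => //.
apply: coefs_in_monic_factor (monD) SD _ => i le_di.
have Pi0 : P`_i = 0.
  by rewrite nth_default // (leq_trans _ le_di) // -ltnS (ltn_predK ltPD).
have -> : (Q * D)`_i = - (P - Q * D)`_i by rewrite coefB Pi0 sub0r opprK.
exact: ideal_opp.
Qed.

End Ideal.

Section Division.

Variable S : R -> Prop.
Hypothesis ringS : is_subring S.

Lemma coefs_in_div D P : D \is monic -> coefs_in S D -> coefs_in S P ->
  exists Q r, [/\ coefs_in S Q, coefs_in S r, P = Q * D + r & (size r < size D)%N].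
Proof.
move=> monD SD SP; have idS := subring_ideal ringS.
have nzD := monic_neq0 monD.
have SQ : coefs_in S (P %/ D).
  apply: (coefs_in_monic_factor idS monD SD) => i le_di.
  have -> : (P %/ D * D)`_i = P`_i; last exact: SP.
  rewrite {2}(divp_eq P D) coefD [X in _ + X]nth_default ?addr0 //.
  by rewrite (leq_trans _ le_di) // -ltnS prednK ?ltn_modp // size_poly_gt0.
exists (P %/ D), (P %% D); split=> //; last by rewrite ltn_modp.
  have -> : P %% D = P - P %/ D * D by rewrite {2}(divp_eq P D) addrC addKr.
  by apply: (coefs_inB idS) => //; apply: (coefs_inM idS).
exact: divp_eq.
Qed.

Lemma coefs_in_cofactor D Q : D \is monic -> coefs_in S D ->
  coefs_in S (Q * D) -> coefs_in S Q.
Proof.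
by move=> monD SD SQD; apply: (coefs_in_monic_factor (subring_ideal ringS) monD).
Qed.

Lemma coefs_in_prod_XsubC (I : Type) (r : seq I) (A : pred I) (x : I -> R) :
  (forall i, A i -> S (x i)) -> coefs_in S (\prod_(i <- r | A i) ('X - (x i)%:P)).
Proof.
have idS := subring_ideal ringS; move=> Sx; elim/big_ind: _ => [|P Q|i Ai].
- by apply: (coefs_inC idS); case: ringS.
- exact: (coefs_inM idS).
- apply: (coefs_inB idS); last exact/(coefs_inC idS)/Sx.
  move=> j; rewrite coefX; case: (j == 1)%N; case: (ringS) (idS) => // S1 _ _.
  by case.
Qed.

End Division.

End SubringPolynomials.

(** * Valuations and simple roots *)

Section Valuation.

Variables (L : fieldType) (w : L -> int).
Hypothesis wM : forall x y : L, x != 0 -> y != 0 -> w (x * y) = w x + w y.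
Hypothesis wD : forall x y : L, x != 0 -> y != 0 -> x + y != 0 ->
  Num.min (w x) (w y) <= w (x + y).

Definition vint (x : L) := (x == 0) || (0 <= w x).
Definition vmax (x : L) := (x == 0) || (0 < w x).

Lemma val1 : w 1 = 0.
Proof.
have : w 1 = w 1 + w 1 by rewrite -wM ?oner_neq0 // mulr1.
by move: (w 1) => a; lia.
Qed.

Lemma valN x : w (- x) = w x.
Proof.
have [->|nzx] := eqVneq x 0; first by rewrite oppr0.
have nzN1 : -1 != 0 :> L by rewrite oppr_eq0 oner_eq0.
have := wM nzN1 nzN1; rewrite mulrNN mulr1 val1 => w2.
by rewrite -mulN1r wM //; lia.
Qed.

Lemma valV x : x != 0 -> w x^-1 = - w x.
Proof.
by move=> nzx; have := wM nzx (invr_neq0 nzx); rewrite mulfV // val1; lia.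
Qed.

Lemma vint_ring : is_subring vint.
Proof.
split=> [|x y|x y]; rewrite /vint.
- by rewrite val1 orbT.
- have [->|nzx] := eqVneq x 0; first by rewrite sub0r oppr_eq0 valN.
  have [->|nzy] := eqVneq y 0; first by rewrite subr0 (negPf nzx).
  move=> /= x0 y0; case: eqVneq => //= nzxy.
  by have := wD nzx _ nzxy; rewrite oppr_eq0 nzy valN ge_min => /(_ isT) /orP[]; lia.
- have [->|nzx] := eqVneq x 0; first by rewrite mul0r eqxx.
  have [->|nzy] := eqVneq y 0; first by rewrite mulr0 eqxx.
  by move=> /= x0 y0; rewrite wM // addr_ge0 ?orbT.
Qed.

Lemma vmax_ideal : is_ideal vint vmax.
Proof.
split=> [|x y|x y]; rewrite /vmax /vint.
- by rewrite eqxx.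
- have [->|nzx] := eqVneq x 0; first by rewrite sub0r oppr_eq0 valN.
  have [->|nzy] := eqVneq y 0; first by rewrite subr0 (negPf nzx).
  move=> /= x0 y0; case: eqVneq => //= nzxy.
  by have := wD nzx _ nzxy; rewrite oppr_eq0 nzy valN ge_min => /(_ isT) /orP[]; lia.
- have [->|nzx] := eqVneq x 0; first by rewrite mul0r eqxx.
  have [->|nzy] := eqVneq y 0; first by rewrite mulr0 eqxx.
  by move=> /= x0 y0; rewrite wM // ltr_wpDl ?orbT.
Qed.

Lemma vmax_vint x : vmax x -> vint x.
Proof. by rewrite /vmax /vint; case: eqP => //= _; lia. Qed.

Lemma vint_Nvmax x : vint x -> ~~ vmax x -> x != 0 /\ w x = 0.
Proof. by rewrite /vmax /vint; case: eqP => //= _; lia. Qed.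

Lemma Nvmax1 : ~~ vmax 1.
Proof. by rewrite /vmax oner_eq0 val1. Qed.

Lemma vint_inv x : ~~ vmax x -> vint x^-1.
Proof.
by rewrite /vmax /vint invr_eq0; case: eqVneq => //= nzx; rewrite valV //; lia.
Qed.

Lemma vmax_inv x : ~~ vint x -> vmax x^-1.
Proof.
by rewrite /vmax /vint invr_eq0; case: eqVneq => //= nzx; rewrite valV //; lia.
Qed.

Lemma vmax_mul x y : vint x -> vint y -> vmax (x * y) -> vmax x || vmax y.
Proof.
move=> Ox Oy; apply: contraLR; rewrite negb_or => /andP[].
move=> /(vint_Nvmax Ox)[nzx wx] /(vint_Nvmax Oy)[nzy wy].
by rewrite /vmax mulf_eq0 (negPf nzx) (negPf nzy) /= wM // wx wy.
Qed.

(** The content in the sense of Gauss: a coefficient of least value is factored out. *)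
Lemma coefs_content (E : L -> Prop) (T : {poly L}) :
    (forall x y, E x -> E y -> E (x / y)) -> coefs_in E T -> T != 0 ->
  exists i T', [/\ T`_i != 0, T = T`_i *: T' & coefs_in (fun x => E x /\ vint x) T'].
Proof.
move=> Ediv ET nzT.
have sz0 : (0 < size T)%N by rewrite size_poly_gt0.
have lt0 : ((size T).-1 < size T)%N by rewrite prednK.
pose i0 := Ordinal lt0; have Pi0 : T`_i0 != 0 by rewrite -lead_coefE lead_coef_eq0.
case: (@Order.TotalTheory.arg_minP _ _ _ i0 (fun i => T`_i != 0)
  (fun i : 'I_(size T) => w T`_i) Pi0) => i nzi min_i.
exists (i : nat), ((T`_i)^-1 *: T); split=> //.
  by rewrite scalerA mulfV // scale1r.
move=> j; rewrite coefZ mulrC; split; first exact: Ediv.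
rewrite /vint; case: eqVneq => //= nzj.
have nzTj : T`_j != 0 by apply: contraNneq nzj => ->; rewrite mul0r.
have ltj : (j < size T)%N by rewrite ltnNge; apply: contra nzTj => /leq_sizeP->.
by have := min_i (Ordinal ltj) nzTj; rewrite wM ?invr_neq0 // valV //= subr_ge0.
Qed.

Section SimpleRoot.

Variable E : L -> Prop.
Hypothesis ringE : is_subring E.
Hypothesis Einv : forall x, E x -> E x^-1.
Variable z : L.
Hypothesis Oz : vint z.

Let OE x := E x /\ vint x.
Let ME x := E x /\ vmax x.

Let ringOE : is_subring OE.
Proof.
case: ringE => E1 EB EM; case: vint_ring => O1 OB OM.
by split=> // x y [? ?] [? ?]; split; auto.
Qed.

Let idME : is_ideal OE ME.
Proof.
case: ringE => E1 EB EM; case: vmax_ideal => O1 OB OM.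
split=> [|x y [? ?] [? ?]|x y [? ?] [? ?]]; split; auto.
by rewrite -(subrr 1); apply: EB.
Qed.

Let OE_vint P : coefs_in OE P -> coefs_in vint P.
Proof. by move=> OP i; case: (OP i). Qed.

Let ME_vmax P : coefs_in ME P -> coefs_in vmax P.
Proof. by move=> OP i; case: (OP i). Qed.

Let OEz P : coefs_in OE P -> vint P.[z].
Proof.
move=> /OE_vint OP.
exact: (coefs_in_horner vint_ring (subring_ideal vint_ring)).
Qed.

Let MEz P : coefs_in ME P -> vmax P.[z].
Proof. by move=> /ME_vmax MP; apply: (coefs_in_horner vint_ring vmax_ideal). Qed.

(** The reduction of [C] is a nonzero polynomial vanishing at the residue of [z]. Leading
    coefficients of positive value are dropped, and the first unit met is divided out. *)
Lemma coefs_in_truncate C :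
    coefs_in OE C -> vmax C.[z] -> ~ coefs_in ME C ->
  exists D, [/\ D \is monic, coefs_in OE D, vmax D.[z] & (size D <= size C)%N].
Proof.
move: {2}(size C) (leqnn (size C)) => n; elim: n C => [|n IHn] C szC OC Cz nMC.
  case: nMC; move: szC; rewrite leqn0 size_poly_eq0 => /eqP->.
  exact: (coefs_in0 idME).
have [szCn|/eqP szCn] : (size C <= n)%N \/ size C == n.+1.
  by move: szC; rewrite leq_eqVlt => /orP[]; [right | left].
  exact: IHn.
have Cn : C`_n = lead_coef C by rewrite lead_coefE szCn.
have nzC : C != 0 by rewrite -size_poly_eq0 szCn.
have [MCn|nMCn] := boolP (vmax C`_n); last first.
  exists ((C`_n)^-1 *: C); split.
  - by rewrite monicE lead_coefZ Cn mulVf ?lead_coef_eq0.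
  - move=> i; rewrite coefZ; case: ringOE => _ _ OEM; apply: OEM => //.
    by split; [apply/Einv; case: (OC n) | apply: vint_inv].
  - rewrite hornerZ; case: vmax_ideal => _ _ MM; apply: MM => //.
    exact: vint_inv.
  - exact: size_scale_leq.
have Dtake : take_poly n C = C - C`_n *: 'X^n.
  apply/polyP=> i; rewrite coefB coefZ coefXn coef_take_poly.
  case: ltngtP => [_|lt_ni|->]; rewrite ?mulr0 ?subr0 ?mulr1 ?subrr //.
  by rewrite nth_default ?szCn.
have MX : coefs_in ME (C`_n *: 'X^n).
  move=> i; rewrite coefZ coefXn; case: (i == n); last by rewrite mulr0; case: idME.
  by rewrite mulr1; split=> //; case: (OC n).
case: (IHn (take_poly n C)).
- exact: size_take_poly.
- by move=> i; rewrite coef_take_poly; case: ifP => // _; case: (subring_ideal ringOE).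
- by rewrite Dtake hornerD hornerN; case: vmax_ideal => _ MB _; apply: MB => //; apply: MEz.
- move=> MT; apply: nMC; rewrite -[C](subrK (C`_n *: 'X^n)) -Dtake.
  exact: (coefs_inD idME).
- move=> D [monD OD Dz szD]; exists D; split=> //.
  by rewrite (leq_trans szD) // (leq_trans (size_take_poly _ _)) // szCn.
Qed.

(** The last clause says that [D] reduces to the minimal polynomial of the residue of [z], without
    forming a residue field. *)
Lemma min_monic_vmax C :
    coefs_in OE C -> vmax C.[z] -> ~ coefs_in ME C ->
  exists D, [/\ D \is monic, coefs_in OE D, vmax D.[z]
    & forall r, coefs_in OE r -> vmax r.[z] -> (size r < size D)%N -> coefs_in ME r].
Proof.
have [n] := ubnP (size C); elim: n C => // n IHn C szC OC Cz nMC.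
have [D [monD OD Dz szD]] := coefs_in_truncate OC Cz nMC.
have [[r [Or rz szr nMr]]|noR] := classic (exists r,
  [/\ coefs_in OE r, vmax r.[z], (size r < size D)%N & ~ coefs_in ME r]).
  by apply: (IHn r) => //; lia.
exists D; split=> // r Or rz szr; apply: NNPP => nMr; apply: noR.
by exists r.
Qed.

(* A simple root of an integral polynomial generates an unramified extension.
   Let D be a lift of the minimal polynomial of the residue of z and P = Q0 D + r0;
   simplicity makes Q0(z) a unit, so D(z), hence every element of E[z] of
   positive value, is up to a unit a combination of elements of ME with
   coefficients in OE[z]: divide by the content and descend on the value. *)
Lemma simple_root_value P y :
    coefs_in OE P -> P.[z] = 0 -> ~~ vmax P^`().[z] ->
    (exists2 C, coefs_in E C & y = C.[z]) -> y != 0 ->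
  exists a, [/\ E a, a != 0 & w a = w y].
Proof.
move=> OP Pz P'z; have [E1 EB EM] := ringE.
have Ediv x1 x2 : E x1 -> E x2 -> E (x1 / x2) by move=> ? ?; apply/EM/Einv.
have Mz0 : vmax 0 by rewrite /vmax eqxx.
have nMP : ~ coefs_in ME P.
  by move=> MP; case/negP: P'z; apply/MEz/(coefs_in_deriv idME).
have vP : vmax P.[z] by rewrite Pz.
have [D [monD OD Dz minD]] := min_monic_vmax OP vP nMP.
have [_ MB MM] := vmax_ideal; have MA := ideal_add vmax_ideal.
have MN := ideal_opp vmax_ideal.
have divD C : coefs_in OE C -> vmax C.[z] ->
    exists Q r, [/\ coefs_in OE Q, coefs_in ME r & C = Q * D + r].
  move=> OC Cz; have [Q [r [OQ Or DC szr]]] := coefs_in_div ringOE monD OD OC.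
  exists Q, r; split=> //; apply: minD => //.
  have -> : r.[z] = C.[z] - Q.[z] * D.[z] by rewrite DC !hornerE addrC addKr.
  by apply: MB => //; apply: MM => //; apply: OEz.
have [Q0 [r0 [OQ0 Mr0 DP]]] := divD P OP vP.
have MQ0 : ~~ vmax Q0.[z].
  apply: contra P'z => MQ0; rewrite DP !derivE !hornerE.
  apply: (MA); last exact/MEz/(coefs_in_deriv idME).
  apply: (MA); first by apply: MM => //; apply/OEz/(coefs_in_deriv (subring_ideal ringOE)).
  by rewrite mulrC; apply: MM => //; apply/OEz/(coefs_in_deriv (subring_ideal ringOE)).
have [nzQ0 wQ0] := vint_Nvmax (OEz OQ0) MQ0.
have main n C : coefs_in OE C -> C.[z] != 0 -> w C.[z] = n%:Z ->
    exists a, [/\ E a, a != 0 & w a = w C.[z]].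
  elim/ltn_ind: n C => n IHn C OC nzC wC.
  have [MC|nMC] := boolP (vmax C.[z]); last first.
    exists 1; rewrite oner_eq0; split=> //; rewrite val1.
    by case: (vint_Nvmax (OEz OC) nMC).
  have [Q [r [OQ Mr DC]]] := divD C OC MC.
  (* Eliminating [D] between [C = Q * D + r] and [P = Q0 * D + r0] yields coefficients in [ME] and a
     value at [z] that is [C.[z]] times a unit. *)
  pose T := Q0 * r - Q * r0.
  have MT : coefs_in ME T by apply: (coefs_inB idME); apply: (coefs_inM idME).
  have DT : T.[z] = C.[z] * Q0.[z].
    have r0z : r0.[z] = - (Q0.[z] * D.[z]).
      have := Pz; rewrite DP !hornerE addrC => /eqP; rewrite addr_eq0.
      by move/eqP.
    by rewrite /T DC !hornerE r0z; ring.
  have nzT : T.[z] != 0 by rewrite DT mulf_neq0.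
  have nzT0 : T != 0 by apply: contraNneq nzT => ->; rewrite horner0.
  have [i [T' [nzTi DT' OT']]] : exists i T',
      [/\ T`_i != 0, T = T`_i *: T' & coefs_in OE T'].
    by apply: (@coefs_content E) => // i; case: (MT i).
  have [ETi MTi] := MT i.
  have wTi : 0 < w T`_i by move: MTi; rewrite /vmax (negPf nzTi).
  have DT'z : T.[z] = T`_i * T'.[z] by rewrite {1}DT' hornerZ.
  have nzT'z : T'.[z] != 0.
    by apply: contraNneq nzT => T'0; rewrite DT'z T'0 mulr0.
  have wT' : w C.[z] = w T`_i + w T'.[z].
    by rewrite -wM // -DT'z DT wM // wQ0 addr0.
  have wT'0 : 0 <= w T'.[z] by have := OEz OT'; rewrite /vint (negPf nzT'z).
  have lt_n : (`|w T'.[z]| < n)%N.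
    by rewrite -ltz_nat gez0_abs // -wC wT' ltrDr.
  have wabs : w T'.[z] = `|w T'.[z]|%N by rewrite gez0_abs.
  have [a [Ea nza wa]] := IHn _ lt_n T' OT' nzT'z wabs.
  exists (T`_i * a); split; [exact: EM | by rewrite mulf_neq0 |].
  by rewrite wM // wa.
case=> C EC -> nzC.
have nzC0 : C != 0 by apply: contraNneq nzC => ->; rewrite horner0.
have [i [C' [nzCi DC OC']]] := coefs_content Ediv EC nzC0.
have DCz : C.[z] = C`_i * C'.[z] by rewrite {1}DC hornerZ.
have nzC'z : C'.[z] != 0 by apply: contraNneq nzC => C0; rewrite DCz C0 mulr0.
have wC'0 : 0 <= w C'.[z] by have := OEz OC'; rewrite /vint (negPf nzC'z).
have wabs : w C'.[z] = `|w C'.[z]|%N by rewrite gez0_abs.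
have [a [Ea nza wa]] := main _ C' OC' nzC'z wabs.
exists (C`_i * a); split; [exact: EM | by rewrite mulf_neq0 |].
by rewrite DCz !wM // wa.
Qed.

End SimpleRoot.

End Valuation.

(** * Counting the roots that are not simple modulo a place *)

Section RamifiedRoots.

Variables (L : fieldType) (w : L -> int).
Hypothesis wM : forall x y : L, x != 0 -> y != 0 -> w (x * y) = w x + w y.
Hypothesis wD : forall x y : L, x != 0 -> y != 0 -> x + y != 0 ->
  Num.min (w x) (w y) <= w (x + y).

Local Notation O := (vint w).
Local Notation M := (vmax w).
Let ringO : is_subring O := vint_ring wM wD.
Let idO : is_ideal O O := subring_ideal ringO.
Let idM : is_ideal O M := vmax_ideal wM wD.

Let coefs_inMr P Q : coefs_in M P -> coefs_in O Q -> coefs_in M (P * Q).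
Proof. by move=> MP OQ; rewrite mulrC; apply: (coefs_inM idM). Qed.

Let coefs_vmax_vint P : coefs_in M P -> coefs_in O P.
Proof. by move=> MP i; apply: vmax_vint. Qed.

Variables (I : finType) (x : I -> L) (a : L).
(** The factor [a] is for the places over t = oo: there the equation is f / t, its leading
    coefficient is not a unit, and some roots are not integral. *)
Let P := a *: \prod_(i : I) ('X - (x i)%:P).
Hypothesis OP : coefs_in O P.

Let P_split (S : pred I) : P =
  (a *: \prod_(i | ~~ S i) ('X - (x i)%:P)) * \prod_(i | S i) ('X - (x i)%:P).
Proof. by rewrite /P (bigID S) /= mulrC scalerAl. Qed.

Let cofactor_vint (S : pred I) : (forall i, S i -> O (x i)) ->
  coefs_in O (a *: \prod_(i | ~~ S i) ('X - (x i)%:P)).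
Proof.
move=> OS; apply: (coefs_in_cofactor ringO (D := \prod_(i | S i) ('X - (x i)%:P))).
- exact: monic_prod_XsubC.
- exact: (coefs_in_prod_XsubC ringO).
- by rewrite -P_split.
Qed.

(** A non-integral root contributes [1 - (x i)^-1 *: 'X], which is 1 modulo [M], once the constants
    are gathered in [c]. So [P] reduces to [c] times the product over the integral roots, and a unit
    coefficient at [d] forces that product to have degree at least [d]. *)
Lemma card_Nvint_roots d : ~~ M P`_d -> (#|[set i | ~~ O (x i)]| + d <= #|I|)%N.
Proof.
move=> nMPd; pose D := \prod_(i | O (x i)) ('X - (x i)%:P).
pose Q := a *: \prod_(i | ~~ O (x i)) ('X - (x i)%:P).
have OQ : coefs_in O Q by apply: cofactor_vint.
have OD : coefs_in O D by apply: (coefs_in_prod_XsubC ringO).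
pose R := \prod_(i | ~~ O (x i)) (1 - (x i)^-1 *: 'X).
have OC1 : coefs_in O 1 by apply: (coefs_inC idO); case: ringO.
have MR : coefs_in M (R - 1).
  rewrite /R; elim/big_rec: _ => [|i r NOi Mr]; first by rewrite subrr; apply: (coefs_in0 idM).
  have -> : (1 - (x i)^-1 *: 'X) * r - 1 = (r - 1) - (x i)^-1 *: 'X * r by ring.
  apply: (coefs_inB idM) => //; apply: coefs_inMr.
    move=> j; rewrite coefZ coefX; case: (j == _).
      by rewrite mulr1; apply: (vmax_inv wM).
    by rewrite mulr0; case: idM.
  by rewrite -[r](subrK 1); apply: (coefs_inD idO) => //; apply: coefs_vmax_vint.
pose c := a * \prod_(i | ~~ O (x i)) (- x i).
have DQ : Q = c *: R.
  rewrite /Q /c -scalerA; congr (_ *: _); rewrite /R -scaler_prod.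
  apply: eq_bigr => i NOi; rewrite scalerBr scalerA mulNr mulfV.
    by rewrite scaleN1r opprK alg_polyC polyCN addrC.
  by apply: contraNneq NOi => ->; rewrite /vint eqxx.
have Oc : O c.
  have := OQ 0%N; rewrite -horner_coef0 DQ hornerZ /R horner_prod big1 ?mulr1 //.
  by move=> i _; rewrite !hornerE ?mulr0 ?subr0.
have MPcD : coefs_in M (P - c%:P * D).
  rewrite (P_split (fun i => O (x i))) -mulrBl -/Q DQ -mul_polyC -[X in _ - X]mulr1.
  rewrite -mulrBr; apply: coefs_inMr => //.
  by apply: (coefs_inM idM) => //; apply: (coefs_inC idO).
have ltd : (d < size D)%N.
  rewrite ltnNge; apply: contra nMPd => szD.
  have := MPcD d; rewrite coefB coefCM [D`_d]nth_default // mulr0 subr0.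
  done.
have szD : size D = #|[set i | O (x i)]|.+1.
  rewrite /D -big_enum /= size_prod_XsubC -cardE; congr _.+1.
  by apply: eq_card => i; rewrite !inE.
have := cardsC [set i | O (x i)]; rewrite szD in ltd.
suff -> : ~: [set i | O (x i)] = [set i | ~~ O (x i)] by lia.
by apply/setP=> i; rewrite !inE.
Qed.

Variables (y W : {poly L}).
Hypotheses (Oy : coefs_in O y) (OW : coefs_in O W) (nMW : ~ coefs_in M W).
Hypothesis DW : W = P^`() * y - P * y^`().

(** Modulo [M], [P] is divisible by the power of X - c with exponent [#|S|], hence [W] by the
    preceding power. As [W] is nonzero modulo [M], [#|S| - 1] is at most its degree. *)
Lemma card_congruent_roots (S : {set I}) c : O c ->
    (forall i, i \in S -> O (x i) && M (x i - c)) ->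
  (#|S| <= size W)%N.
Proof.
move=> Oc OS; rewrite leqNgt; apply/negP=> ltWS; apply: nMW.
pose Q := a *: \prod_(i | i \notin S) ('X - (x i)%:P).
pose D := \prod_(i in S) ('X - (x i)%:P).
have OQ : coefs_in O Q by apply: cofactor_vint => i /OS/andP[].
have OX : coefs_in O 'X.
  by move=> i; rewrite coefX; case: (i == _); case: idO => // _ _ _; case: ringO.
pose E := 'X - c%:P.
have OE : coefs_in O E by apply: (coefs_inB idO) => //; apply: (coefs_inC idO).
have OEn n : coefs_in O (E ^+ n).
  elim: n => [|n IHn]; first by apply: (coefs_inC idO); case: ringO.
  by rewrite exprS; apply: (coefs_inM idO).
have [OD MD] : coefs_in O D /\ coefs_in M (D - E ^+ #|S|).
  rewrite /D -prodr_const; elim/big_rec2: _ => [|i p2 p1 /OS/andP[Oi Mi] [O1 M12]].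
    rewrite subrr; split; last exact: (coefs_in0 idM).
    by apply: (coefs_inC idO); case: ringO.
  have OXi : coefs_in O ('X - (x i)%:P).
    by apply: (coefs_inB idO) => //; apply: (coefs_inC idO).
  split; first exact: (coefs_inM idO).
  have -> : ('X - (x i)%:P) * p1 - E * p2 =
      ('X - (x i)%:P) * (p1 - p2) - (x i - c)%:P * p2.
    by rewrite /E polyCB; ring.
  apply: (coefs_inB idM); first exact: (coefs_inM idM).
  apply: coefs_inMr; first exact: (coefs_inC idM).
  have -> : p2 = p1 - (p1 - p2) by ring.
  by apply: (coefs_inB idO) => //; apply: coefs_vmax_vint.
have [k Sk] : exists k, #|S| = k.+1 by case: #|S| ltWS => // k _; exists k.
pose m := Q * (D - E ^+ k.+1).
have Mm : coefs_in M m by rewrite /m -Sk; apply: (coefs_inM idM).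
have DP : P = Q * E ^+ k.+1 + m.
  rewrite /m mulrBr addrC subrK (P_split (fun i => i \in S)) -/Q; congr (_ * _).
have dE : E^`() = 1 by rewrite /E derivB derivX derivC subr0.
pose T := (Q^`() * E + Q *+ k.+1) * y - Q * E * y^`().
have OT : coefs_in O T.
  apply: (coefs_inB idO); apply: (coefs_inM idO) => //.
  - apply: (coefs_inD idO).
      by apply: (coefs_inM idO) => //; apply: (coefs_in_deriv idO).
    elim: k.+1 => [|n IHn]; first exact: (coefs_in0 idO).
    by rewrite mulrSr; apply: (coefs_inD idO).
  - exact: (coefs_inM idO).
  - exact: (coefs_in_deriv idO).
have monE : E ^+ k \is monic by rewrite monic_exp ?monicXsubC.
apply: (coefs_in_small_mod idM monE (OEn k) OT); last first.
  by rewrite size_exp_XsubC -Sk.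
have -> : W - T * E ^+ k = m^`() * y - m * y^`().
  have dEn : (E ^+ k.+1)^`() = E ^+ k *+ k.+1.
    by rewrite deriv_exp dE mul1r.
  have aux (q q' e ek n z z' b b' : {poly L}) :
      (q' * (e * ek) + q * (ek * n) + b') * z - (q * (e * ek) + b) * z' -
      ((q' * e + q * n) * z - q * e * z') * ek = b' * z - b * z' by ring.
  rewrite DW [X in X^`()]DP [X in _ - X * _ - _]DP derivD derivM dEn /T.
  by rewrite -(mulr_natr Q) -(mulr_natr (E ^+ k)) exprS aux.
apply: (coefs_inB idM); apply: coefs_inMr => //.
  exact: (coefs_in_deriv idM).
exact: (coefs_in_deriv idO).
Qed.

(** The residues of [rs] are distinct roots of the reduction of [W], which is nonzero. The linear
    factors are split off one by one modulo [M]. *)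
Lemma size_incongruent_roots (rs : seq L) :
    all (fun r => O r && M W.[r]) rs ->
    pairwise (fun r s => ~~ M (r - s)) rs -> (size rs < size W)%N.
Proof.
move=> Ors Prs; rewrite ltnNge; apply/negP=> leW; apply: nMW.
pose D (s : seq L) := \prod_(r <- s) ('X - r%:P).
have [Q OQ MQ] : exists2 Q, coefs_in O Q & coefs_in M (W - Q * D rs).
  elim: rs Ors Prs {leW} => [|r rs IHrs] /=.
    by exists W => //; rewrite /D big_nil mulr1 subrr; apply: (coefs_in0 idM).
  case/andP=> /andP[Or Wr] Ors /andP[Nr Prs]; have [Q OQ MQ] := IHrs Ors Prs.
  have OD : coefs_in O (D rs).
    rewrite /D big_seq; apply: (coefs_in_prod_XsubC ringO) => s s_rs.
    by case/andP: (allP Ors _ s_rs).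
  have nMDr : ~~ M (D rs).[r].
    rewrite /D horner_prod; elim: rs Ors Nr {IHrs Prs OD MQ} => [|s rs IHrs] /=.
      by rewrite big_nil (Nvmax1 wM).
    case/andP=> /andP[Os _] Ors /andP[Ns Nr]; rewrite big_cons !hornerE.
    apply: contra Ns => /(vmax_mul wM); case/(_ _ _)/orP=> //.
    - by case: ringO => _ OB _; apply: OB.
    - rewrite (big_seq _); apply: (subring_prod ringO) => t t_rs.
      rewrite !hornerE; case: ringO => _ OB _; apply: OB => //.
      by case/andP: (allP Ors _ t_rs).
    - by move=> Mr; case/negP: (IHrs Ors Nr).
  have MQr : M Q.[r].
    have : M (Q.[r] * (D rs).[r]).
      have -> : Q.[r] * (D rs).[r] = W.[r] - (W - Q * D rs).[r].
        by rewrite !hornerE opprB addrC subrK.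
      case: idM => _ MB _; apply: MB => //.
      exact: (coefs_in_horner ringO idM).
    move/(vmax_mul wM); case/(_ _ _)/orP=> //.
    - exact: (coefs_in_horner ringO idO).
    - exact: (coefs_in_horner ringO idO).
    - by rewrite (negPf nMDr).
  have OX : coefs_in O ('X - r%:P).
    have := @coefs_in_prod_XsubC _ O ringO unit [:: tt] xpredT (fun=> r) (fun _ _ => Or).
    by rewrite big_seq1.
  have [Q1 [q [OQ1 Oq DQ szq]]] := coefs_in_div ringO (monicXsubC r) OX OQ.
  have Dq : q = (Q.[r])%:P.
    rewrite size_XsubC ltnS in szq; rewrite (size1_polyC szq) DQ !hornerE subrr mulr0.
    by rewrite add0r (size1_polyC szq) hornerC coefC.
  exists Q1 => //; rewrite /D big_cons -/(D rs).
  have -> : W - Q1 * (('X - r%:P) * D rs) = (W - Q * D rs) + q * D rs.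
    by rewrite DQ; ring.
  apply: (coefs_inD idM) => //; apply: coefs_inMr => //.
  by rewrite Dq; apply: (coefs_inC idM).
have monD : D rs \is monic by apply: monic_prod_XsubC.
apply: (coefs_in_small_mod idM monD _ OQ MQ).
  rewrite /D big_seq; apply: (coefs_in_prod_XsubC ringO) => s s_rs.
  by case/andP: (allP Ors _ s_rs).
by rewrite /D size_prod_XsubC ltnS.
Qed.

(** These roots occupy at most deg W residue classes, each with at most [size W] of them. *)
Lemma card_ramified_roots :
  (#|[set i | O (x i) && M W.[x i]]| <= (size W).-1 * size W)%N.
Proof.
set T := [set i | _].
suff [rs [Prs rsT leT]] : exists rs : seq L,
    [/\ pairwise (fun r s => ~~ M (r - s)) rs,
        forall r, r \in rs -> exists2 i, i \in T & r = x i
      & (#|T| <= size rs * size W)%N].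
  have : (size rs < size W)%N.
    apply: size_incongruent_roots Prs; apply/allP=> r /rsT[i].
    by rewrite inE => OMi ->.
  by case: (size W) leT => // d leT lt_d; rewrite (leq_trans leT) // leq_mul2r orbC -ltnS lt_d.
have : forall i, i \in T -> O (x i) by move=> i; rewrite inE => /andP[].
have [n] := ubnP #|T|; elim: n T => // n IHn T ltTn OT.
have [->|[i Ti]] := set_0Vmem T.
  by exists [::]; split=> //; rewrite cards0.
pose C := [set j in T | M (x j - x i)].
have leC : (#|C| <= size W)%N.
  apply: (card_congruent_roots (OT i Ti)) => j; rewrite inE => /andP[Tj ->].
  by rewrite OT.
have iC : i \in C by rewrite inE Ti subrr /vmax eqxx.
have sCT : C \subset T by apply/subsetP=> j; rewrite inE => /andP[].
have cT := cardsID C T; rewrite (setIidPr sCT) in cT.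
have C0 : (0 < #|C|)%N by apply/card_gt0P; exists i.
have [||rs [Prs rsT leT]] := IHn (T :\: C).
- by lia.
- by move=> j /setDP[Tj _]; apply: OT.
exists (x i :: rs); split=> /=.
- rewrite Prs andbT; apply/allP=> r /rsT[j /setDP[Tj nCj] ->].
  apply: contra nCj => Mij; rewrite inE Tj /= -opprB.
  exact: (ideal_opp idM).
- move=> r; rewrite inE => /predU1P[->|/rsT[j /setDP[Tj _] ->]]; first by exists i.
  by exists j.
- by rewrite mulSn -cT leq_add.
Qed.

End RamifiedRoots.

(** * A rational function with few critical points *)

Definition wronskian (F : fieldType) (g h : {poly F}) := g^`() * h - g * h^`().

(** [rd_gap] bounds by [p ^ 2 + p] the order of the pole of g/h at infinity and [rd_size_wronskian]
    bounds by [p] the degree of the finite critical divisor; neither bound involves [m].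
    [rd_coprime_wronskian] makes the zeros of [g] other than 0 simple. *)
Record ramification_data (F : fieldType) (p m : nat) (g h v : {poly F}) : Prop := {
  rd_monic : g \is monic;
  rd_size : size g = m.+1;
  rd_size_h : (size h <= m)%N;
  rd_gap : (m < size h + p ^ 2 + p)%N;
  rd_coprime : coprimep g h;
  rd_double : g = 'X^2 * v;
  rd_v0 : v.[0] != 0;
  rd_h0 : h.[0] != 0;
  rd_wronskian : wronskian g h != 0;
  rd_size_wronskian : (size (wronskian g h) <= p.+1)%N;
  rd_coprime_wronskian : coprimep v (wronskian g h) }.

Section RamificationData.

Variables (p : nat) (F : fieldType).
Hypotheses (pr_p : prime p) (charFp : p \in [pchar F]).

Lemma deriv_pexp (q : {poly F}) n : (q ^+ (p * n))^`() = 0.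
Proof.
by rewrite deriv_exp mulrnA -[_ *+ p]mulr_natr -polyC_natr (pcharf0 charFp) mulr0 mul0rn.
Qed.

(* With u = X^2 + X^(k+2) and h = 1 + u X^(pe), the function g/h equals
   C^p + u/h; it has the same derivative as 1/(X^(pe) + 1/u), so only the zeros
   of u' = C are critical. The factor X of C makes X = 0 a double zero of g,
   alone in its fibre because C vanishes at the other critical points and u does
   not. The leading term of C^p reduces the ramification at infinity to deg C^p. *)
Lemma ramification_data_exists_aux (k e : nat) :
    (k.+2 <= p.+1)%N -> k.+2%:R != 0 :> F ->
    (if k == 0%N then 2%:R != 0 :> F else k%:R != 0 :> F) ->
  exists g h v, ramification_data (F := F) p (p * k.+1 + p * e + k.+2) g h v.
Proof.
move=> lekp nzk2 nzk; have p_gt1 := prime_gt1 pr_p.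
pose u1 : {poly F} := 1 + 'X^k; pose u := 'X^2 * u1.
pose W1 : {poly F} := 2%:R%:P + k.+2%:R *: 'X^k; pose C := 'X * W1.
pose h := 1 + u * 'X^(p * e); pose g := C ^+ p * h + u.
pose v := u1 + 'X^(p - 2) * W1 ^+ p * h.
have szS (a b : F) : (if k == 0%N then a + b else b) != 0 ->
    size (a%:P + b *: 'X^k) = k.+1.
  case: (posnP k) => [->|k0] nz.
    by rewrite expr0 alg_polyC -polyCD size_polyC; move: nz; case: eqP.
  rewrite /= in nz.
  have szb : size (b *: 'X^k) = k.+1 by rewrite size_scale ?size_polyXn.
  by rewrite addrC size_polyDl szb // ltnS (leq_trans (size_polyC_leq1 _)).
have szu1 : size u1 = k.+1.
  rewrite /u1 -[X in _ + X]scale1r -[1 in X in X + _]polyC1; apply: szS.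
  by case: eqP nzk => // _; rewrite oner_eq0.
have szW1 : size W1 = k.+1.
  apply: szS; case: (k =P 0%N) nzk => // -> nz2.
  by rewrite -natrD (natrM _ 2 2) mulf_neq0.
have nzu1 : u1 != 0 by rewrite -size_poly_eq0 szu1.
have nzW1 : W1 != 0 by rewrite -size_poly_eq0 szW1.
have nzX : 'X != 0 :> {poly F} by rewrite polyX_eq0.
have nzXn n : 'X^n != 0 :> {poly F} by rewrite expf_neq0.
have nzC : C != 0 by rewrite mulf_neq0.
have nzu : u != 0 by rewrite mulf_neq0.
have szC : size C = k.+2 by rewrite /C size_mul // size_polyX szW1.
have szu : size u = k.+3 by rewrite /u size_mul // size_polyXn szu1.
have szh : size h = (k.+3 + p * e)%N.
  have szuX : size (u * 'X^(p * e)) = (k.+3 + p * e)%N.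
    by rewrite size_mul // size_polyXn szu addnS.
  by rewrite /h addrC size_polyDl szuX // size_poly1.
have nzh : h != 0 by rewrite -size_poly_eq0 szh.
have szCp : size (C ^+ p) = (p * k.+1).+1.
  by rewrite -(prednK (_ : 0 < size (C ^+ p))%N) ?size_poly_gt0 ?expf_neq0 // size_exp szC mulnC.
have szCph : size (C ^+ p * h) = (p * k.+1 + p * e + k.+3)%N.
  by rewrite size_mul ?expf_neq0 // szCp szh addSn /= addnA addnAC.
have szg : size g = (p * k.+1 + p * e + k.+2).+1.
  have : (0 < p * k.+1)%N by rewrite muln_gt0 prime_gt0.
  move=> pk0; rewrite /g size_polyDl szCph ?szu ?addnS //.
  by rewrite -!addnS -[X in (X < _)%N]add0n ltn_add2r addn_gt0 pk0.
have nzg : g != 0 by rewrite -size_poly_eq0 szg.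
have Dg : g = 'X^2 * v.
  have DX : 'X^p = 'X^2 * 'X^(p - 2) :> {poly F} by rewrite -exprD subnKC.
  by rewrite /g /v /u /C exprMn DX; set A := 'X^(p - 2); set B := W1 ^+ p; ring.
have du : u^`() = C.
  rewrite /u /u1 mulrDr mulr1 -exprD derivD !derivXn /C /W1 mulrDr; congr (_ + _).
    by rewrite polyC_natr mulr_natr expr1.
  by rewrite -scalerAr -exprS scaler_nat add2n.
have dg : g^`() = C ^+ p * h^`() + C.
  by rewrite /g derivD derivM -[p in C ^+ p]muln1 deriv_pexp mul0r add0r du.
have dh : h^`() = C * 'X^(p * e).
  by rewrite /h derivD derivM deriv_pexp mulr0 addr0 derivC add0r du.
have DW : wronskian g h = C.
  rewrite /wronskian dg /g dh.
  have -> : (C ^+ p * (C * 'X^(p * e)) + C) * h - (C ^+ p * h + u) * (C * 'X^(p * e))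
    = C * (h - u * 'X^(p * e)) by ring.
  by rewrite /h addrK mulr1.
have v0 : v.[0] != 0.
  rewrite /v /u1 /W1 !hornerE ?hornerXn.
  case: (posnP k) => [k0|k_gt0].
    rewrite k0 /= in nzk *.
    have p2 : (2 < p)%N.
      rewrite ltn_neqAle p_gt1 andbT; apply: contraNneq nzk => Dp.
      by rewrite Dp (pcharf0 charFp).
    have X0 : 0 ^+ (p - 2) = 0 :> F by rewrite expr0n gtn_eqF ?subn_gt0.
    by rewrite X0 !mul0r addr0 expr0.
  rewrite !expr0n [k == 0%N]gtn_eqF //= addr0 mulr0 addr0.
  (* For p = 2 the power ['X^(p - 2)] is 1 and does not vanish at 0, but [W1] does, its constant
     term being 2. *)
  have [p2|p2] := eqVneq p 2%N; last first.
    have lt2p : (2 < p)%N by rewrite ltn_neqAle eq_sym p2.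
    by rewrite subn_eq0 leqNgt lt2p /= !mul0r addr0 oner_eq0.
  have -> : 2 = 0 :> F by rewrite -[RHS](pcharf0 charFp) p2.
  have -> : 0 ^+ p = 0 :> F by rewrite expr0n gtn_eqF ?prime_gt0.
  rewrite mulr0 mul0r.
  by rewrite addr0 oner_eq0.
have h0 : h.[0] != 0.
  by rewrite /h /u !hornerE ?hornerXn expr0n /= !mul0r addr0 oner_eq0.
have cvC : coprimep v C.
  rewrite /C coprimepMr; apply/andP; split.
    by rewrite -['X]subr0 -polyC0 coprimep_XsubC rootE.
  have [k0|k_gt0] := posnP k.
    have /size_poly1P[c nzc ->] : size W1 == 1%N by rewrite szW1 k0.
    by rewrite -alg_polyC coprimepZr ?coprimep1.
  rewrite gtn_eqF // in nzk.
  apply/Bezout_eq1_coprimepP.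
  (* The identity (k + 2) u1 - W1 = k, where k is invertible, and the congruence of [v] to [u1]
     modulo [W1]. *)
  exists ((k.+2%:R / k%:R)%:P, - (k%:R^-1)%:P - (k.+2%:R / k%:R)%:P * ('X^(p - 2) * W1 ^+ p.-1 * h)) => /=.
  have DWp : W1 ^+ p = W1 ^+ p.-1 * W1 by rewrite -exprSr prednK ?prime_gt0.
  rewrite /v DWp.
  set A := _%:P; set B := W1 ^+ _; set Xp := 'X^_.
  have -> : A * (u1 + Xp * (B * W1) * h) + (- (k%:R^-1)%:P - A * (Xp * B * h)) * W1
     = A * u1 - (k%:R^-1)%:P * W1 by ring.
  rewrite /u1 /W1 /A mulrDr mulr1 mulrDr -mul_polyC mulrA -!polyCM.
  rewrite [k%:R^-1 * k.+2%:R]mulrC opprD addrACA subrr addr0 -polyCB.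
  rewrite -addn2 natrD mulrDl mulfV // [2%:R / _]mulrC addrK.
  by [].
have cgh : coprimep g h.
  apply/Bezout_eq1_coprimepP; exists (- 'X^(p * e), 1 + 'X^(p * e) * C ^+ p) => /=.
  have -> : - 'X^(p * e) * g + (1 + 'X^(p * e) * C ^+ p) * h = h - u * 'X^(p * e).
    by rewrite /g; ring.
  by rewrite /h addrK.
have pk0 : (0 < p * k.+1)%N by rewrite muln_gt0 prime_gt0.
have pkp : (p * k.+1 <= p ^ 2)%N by rewrite expnS expn1 leq_mul2l orbC -ltnS lekp.
pose l := (lead_coef g)^-1.
have nzl : l != 0 by rewrite invr_eq0 lead_coef_eq0.
have DlW : wronskian (l *: g) (l *: h) = (l * l) *: C.
  by rewrite /wronskian !derivZ -!scalerAl -!scalerAr !scalerA -scalerBr -DW.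
have nzll : l * l != 0 by rewrite mulf_neq0.
exists (l *: g), (l *: h), (l *: v); split.
- by rewrite monicE lead_coefZ mulVf ?lead_coef_eq0.
- by rewrite size_scale.
- rewrite size_scale // szh; move: (p * k.+1)%N (p * e)%N pk0 {-}k => a b.
  by clear; lia.
- rewrite size_scale // szh.
  move: (p * k.+1)%N (p * e)%N (p ^ 2)%N pkp {-}k => a b c.
  by clear; lia.
- by rewrite coprimepZl // coprimepZr.
- by rewrite Dg scalerAr.
- by rewrite hornerZ mulf_neq0.
- by rewrite hornerZ mulf_neq0.
- by rewrite DlW scaler_eq0 negb_or nzll.
- by rewrite DlW size_scale // szC.
- by rewrite DlW coprimepZl // coprimepZr.
Qed.

Lemma ramification_data_exists m : prime m -> (3 * p ^ 2 <= m)%N ->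
  exists g h v, ramification_data (F := F) p m g h v.
Proof.
move=> pr_m lem; have p_gt1 := prime_gt1 pr_p.
(* The degree produced by the preceding construction is k + 2 modulo p, so [j] represents [m]
   between 2 and p + 1; the residue 1 is represented by p + 1. The lower bound on [m] leaves room
   for a natural number [e]. *)
pose j := (if m %% p == 1 then p.+1 else m %% p)%N.
have ltp := ltn_pmod m (prime_gt0 pr_p).
have nz_mod : (m %% p != 0)%N.
  rewrite -/(p %| m)%N dvdn_prime2 //; apply/eqP=> Dm.
  by move: lem; rewrite -Dm; nia.
have natr_eq0 a : (a%:R == 0 :> F) = (a %% p == 0)%N.
  by rewrite -(dvdn_pcharf charFp).
have [k Dj] : exists k, j = k.+2.
  exists (j - 2)%N; rewrite /j; case: eqP => [_|/eqP]; first by lia.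
  by move: nz_mod; case: (m %% p)%N => [|[|q]] //= _ _; lia.
have jm : j = m %[mod p].
  rewrite /j; case: eqP => [->|_]; last by rewrite modn_mod.
  by rewrite -addn1 modnDl modn_small.
have lej : (j <= p.+1)%N by rewrite /j; case: eqP => // _; lia.
have [e De] : exists e, m = (p * k.+1 + p * e + k.+2)%N.
  exists (m %/ p - j %/ p - k.+1)%N.
  have Em := divn_eq m p; have Ej := divn_eq j p; rewrite jm in Ej.
  have lek : (k.+1 <= p)%N by lia.
  have lejp : (j %/ p <= 1)%N.
    by rewrite -ltnS ltn_divLR ?prime_gt0 //; lia.
  have : (3 * p <= m %/ p)%N by rewrite leq_divRL ?prime_gt0 //; nia.
  by nia.
rewrite De; apply: ramification_data_exists_aux; rewrite -?Dj //.
- by rewrite natr_eq0 jm.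
- case: eqP => [k0|/eqP nzk]; rewrite natr_eq0.
    rewrite k0 in Dj; rewrite -Dj jm; exact: nz_mod.
  have : (k < p)%N by lia.
  by move=> ltk; rewrite modn_small.
Qed.

End RamificationData.

(** * Permutation groups *)

Section PermutationGroups.

Local Open Scope group_scope.

Lemma perm_group_full_tperm (T : finType) (D : {group {perm T}}) a :
  (forall y, tperm a y \in D) -> D :=: [set: {perm T}].
Proof.
move=> Da; apply/eqP; rewrite eqEsubset subsetT /= -(gen_tperm a) gen_subG.
by apply/subsetP=> _ /imsetP[y _ ->].
Qed.

(** Being equal or exchanged by a transposition of [D] is an equivalence relation preserved by [D].
    By transitivity its classes have the same size, which divides the prime [#|T|] and exceeds 1, so
    there is one class. *)
Lemma transitive_tperm_full (T : finType) (D : {group {perm T}}) a b :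
    prime #|T| -> (forall x y, exists2 s, s \in D & s x = y) ->
    a != b -> tperm a b \in D -> D :=: [set: {perm T}].
Proof.
move=> prT trD neq_ab Dab; pose R : rel T := fun x y => tperm x y \in D.
have Rtrans : transitive R.
  move=> y x z Rxy Ryz; rewrite /R; have [->|neq_xz] := eqVneq x z.
    by rewrite tperm1.
  have [<-|neq_yz] := eqVneq y z; first by [].
  by rewrite -(tpermJ_tperm neq_yz neq_xz) groupJ // tpermC.
have eqR : {in [set: T] & &, equivalence_rel R}.
  move=> x y z _ _ _; split=> [|Rxy]; first by rewrite /R tperm1.
  by apply/idP/idP; apply: Rtrans; rewrite // /R tpermC.
have RJ s x y : s \in D -> R x y -> R (s x) (s y).
  by move=> Ds Rxy; rewrite /R -tpermJ groupJ.
pose P := equivalence_partition R [set: T].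
have partP : partition P [set: T] := equivalence_partitionP eqR.
have leC x y : (#|[set z in setT | R x z]| <= #|[set z in setT | R y z]|)%N.
  have [s Ds <-] := trD x y; rewrite -(card_imset _ (@perm_inj _ s)).
  by apply/subset_leq_card/subsetP=> _ /imsetP[z + ->]; rewrite !inE; apply: RJ.
have cardP : {in P, forall A : {set T}, #|A| = #|[set z in setT | R a z]|}.
  by move=> _ /imsetP[x _ ->]; apply/eqP; rewrite eqn_leq !leC.
have := card_uniform_partition cardP partP; rewrite cardsT => DT.
have dvC : (#|[set z in setT | R a z]| %| #|T|)%N by rewrite DT dvdn_mull.
have C2 : (1 < #|[set z in setT | R a z]|)%N.
  by apply/card_gt1P; exists a, b; split=> //; rewrite !inE /R ?tperm1 ?group1.
have CT : [set z in setT | R a z] = setT.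
  apply/eqP; rewrite eqEcard subsetT cardsT /=.
  by case/primeP: prT => _ /(_ _ dvC)/pred2P[C1|->] //; rewrite C1 in C2.
apply: (perm_group_full_tperm (a := a)) => y.
by have /setIdP[] : y \in [set z in setT | R a z] by rewrite CT inE.
Qed.

Lemma normal_tperm_full (T : finType) (B : {group {perm T}}) a b :
  a != b -> (forall s, tperm a b ^ s \in B) -> B :=: [set: {perm T}].
Proof.
move=> neq_ab Bab; apply: (perm_group_full_tperm (a := a)) => y.
have [->|neq_ya] := eqVneq y a; first by rewrite tperm1.
have := Bab (tperm b y); rewrite tpermJ tpermL tpermD // eq_sym //.
Qed.

(** * The diagonal embedding of S_n in S_m *)

Section Diagonal.

Variables n r m : nat.
Hypothesis le_m : (n * r <= m)%N.

Let le_card : (#|{: 'I_n * 'I_r}| <= m)%N.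
Proof. by rewrite card_prod !card_ord. Qed.

Let pt (ab : 'I_n * 'I_r) : 'I_m := widen_ord le_card (enum_rank ab).

Let pt_inj : injective pt.
Proof.
by move=> x y /(congr1 val) /= /val_inj/enum_rank_inj.
Qed.

(** The grid ['I_n * 'I_r] is placed at the beginning of ['I_m]; the points beyond it are fixed,
    which leaves [m] free to be prime. *)
Definition diag_fun (s : 'S_n) (i : 'I_m) :=
  if [pick ab | pt ab == i] is Some ab then pt (s ab.1, ab.2) else i.

Let diag_pt s ab : diag_fun s (pt ab) = pt (s ab.1, ab.2).
Proof.
rewrite /diag_fun; case: pickP => [cd /eqP/pt_inj-> //|/(_ ab)].
by rewrite eqxx.
Qed.

Let diag_out s i : (forall ab, pt ab != i) -> diag_fun s i = i.
Proof. by move=> out; rewrite /diag_fun; case: pickP => // ab; rewrite (negPf (out ab)). Qed.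

Let diagM s t i : diag_fun (s * t) i = diag_fun t (diag_fun s i).
Proof.
have [/existsP[ab /eqP<-]|] := boolP [exists ab, pt ab == i].
  by rewrite !diag_pt permM.
rewrite negb_exists => /forallP out; by rewrite !diag_out.
Qed.

Let diag1 i : diag_fun 1 i = i.
Proof.
have [/existsP[[a b] /eqP<-]|] := boolP [exists ab, pt ab == i].
  by rewrite diag_pt perm1.
by rewrite negb_exists => /forallP out; rewrite diag_out.
Qed.

Let diag_inj s : injective (diag_fun s).
Proof. by apply: (can_inj (g := diag_fun s^-1)) => i; rewrite -diagM mulgV diag1. Qed.

Definition diag_perm s : 'S_m := perm (@diag_inj s).

Lemma diag_permM : {morph diag_perm : s t / s * t}.
Proof. by move=> s t; apply/permP=> i; rewrite permM !permE diagM. Qed.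

Lemma diag_perm_moves s : s != 1 -> (r <= #|[set i | diag_perm s i != i]|)%N.
Proof.
move=> nt_s; have [a neq_a] : exists a, s a != a.
  apply/existsP; rewrite -[X in is_true X]negbK negb_exists; apply: contra nt_s => /forallP fix_s.
  by apply/eqP/permP=> a; rewrite perm1; apply/eqP; rewrite -[_ == _]negbK.
have inj_b : injective (fun b : 'I_r => pt (a, b)).
  by move=> b c /pt_inj[].
rewrite -[r in (r <= _)%N]card_ord -cardsT -(card_imset _ inj_b).
apply/subset_leq_card/subsetP=> _ /imsetP[b _ ->].
rewrite inE permE diag_pt; apply: contra neq_a => /eqP/pt_inj[-> //].
Qed.

End Diagonal.

End PermutationGroups.

(** * Splitting fields and rational functions *)

Section SplittingFields.

Lemma irreducible_factor (F : fieldType) (p : {poly F}) :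
  (1 < size p)%N -> exists2 r, irreducible_poly r & r %| p.
Proof.
have [n] := ubnP (size p); elim: n p => // n IHn p ltpn szp.
have [irr|red] := classic (irreducible_poly p); first by exists p.
have [q [szq dv_q nq]] : exists q : {poly F}, [/\ size q != 1%N, q %| p & ~~ (q %= p)].
  apply: NNPP => no_q; apply: red; split=> // q szq dv_q; apply: NNPP => /negP nq.
  by apply: no_q; exists q.
have nzp : p != 0 by rewrite -size_poly_gt0 ltnW.
have nzq : q != 0 by apply: contraNneq nzp => q0; rewrite -dvd0p -q0.
have ltq : (size q < size p)%N by rewrite ltn_neqAle dvdp_size_eqp // nq dvdp_leq.
have [||r irr_r dv_r] := IHn q; first by lia.
  by move: szq nzq; rewrite -size_poly_gt0; case: (size q) => [|[]].
by exists r => //; apply: dvdp_trans dv_r dv_q.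
Qed.

Lemma splitting_extension (F : fieldType) (p : {poly F}) : p != 0 ->
  exists (L : fieldExtType F) (zs : seq L),
    map_poly (in_alg L) p %= \prod_(z <- zs) ('X - z%:P).
Proof.
have [n] := ubnP (size p); elim: n F p => // n IHn F p ltpn nzp.
have [szp|szp] := leqP (size p) 1.
  exists F^o, [::]; rewrite big_nil -size_poly_eq1 size_map_poly.
  by rewrite eqn_leq szp size_poly_gt0.
have [r irr_r dv_r] := irreducible_factor szp.
have [K _ [x rx0 _]] := irredp_FAdjoin irr_r.
have /factor_theorem[q Dp] : root (map_poly (in_alg K) p) x.
  by rewrite -(divpK dv_r) rmorphM rootM rx0 orbT.
have nzq : q != 0.
  have := nzp; rewrite -(map_poly_eq0 (in_alg K)) Dp mulf_eq0 negb_or.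
  by case/andP.
have ltq : (size q < n)%N.
  have := size_map_poly (in_alg K) p; rewrite Dp size_mul ?polyXsubC_eq0 //.
  by rewrite size_XsubC addn2 /= => Esz; rewrite -ltnS Esz.
have [L [zs Dq]] := IHn K q ltq nzq.
exists (baseFieldType L), (x%:A :: zs).
rewrite big_cons -(eq_map_poly (fun a : F => baseField_scaleE a 1)).
suff : map_poly (in_alg L) (map_poly (in_alg K) p)
    %= ('X - (x%:A)%:P) * \prod_(z <- zs) ('X - z%:P).
  by rewrite -map_poly_comp.
by rewrite Dp rmorphM /= rmorphB /= map_polyX map_polyC mulrC eqp_mull.
Qed.

(** [splitting_extension] does not record that the roots generate, so the subfield they generate is
    taken as the new field. *)
Lemma splitting_field_exists (F : fieldType) (p : {poly F}) : p != 0 ->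
  exists L : splittingFieldType F, splittingFieldFor 1 (map_poly (in_alg L) p) {:L}.
Proof.
move=> /splitting_extension[L [ys Dp]].
pose E := <<1 & ys>>%AS; pose toL := linfun (vsval : subvs_of E -> L).
pose zs := map (vsproj E) ys.
have Dys : map toL zs = ys.
  rewrite -map_comp map_id_in // => y ys_y.
  by rewrite /= lfunE /= vsprojK ?seqv_sub_adjoin.
have split_p : splittingFieldFor 1 (map_poly (in_alg (subvs_of E)) p) {:subvs_of E}.
  exists zs.
    have := Dp; rewrite -{1}Dys big_map => Dp'.
    set q := map_poly _ _; set q' := \prod_(z <- _) _.
    suff : map_poly toL q %= map_poly toL q' by rewrite eqp_map.
    have -> : map_poly toL q = map_poly (in_alg L) p.
      by rewrite -map_poly_comp; apply/eq_map_poly=> a; apply: rmorph_alg.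
    suff -> : map_poly toL q' = \prod_(z <- zs) ('X - (toL z)%:P) by [].
    rewrite rmorph_prod; apply: eq_bigr => z _.
    by rewrite rmorphB /= map_polyX map_polyC.
  apply/vspaceP=> u; rewrite memvf.
  have : toL u \in (toL @: <<1 & zs>>)%VS.
    by rewrite aimg_adjoin_seq aimg1 Dys lfunE /= (valP u).
  by case/memv_imgP=> v Ev; rewrite !lfunE /= => /val_inj->.
have ax : SplittingField.axiom (subvs_of E).
  exists (map_poly (in_alg (subvs_of E)) p) => //.
  by apply/polyOverP=> i; rewrite coef_map /= rpredZ ?mem1v.
pose S := FieldExt_isSplittingField.Build F (subvs_of E) ax.
pose LS : splittingFieldType F := HB.pack (subvs_of E) S.
by exists LS.
Qed.

End SplittingFields.

(** * Polynomials and constants in an extension of F(t) *)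

Section RationalFunctions.

Variable F : fieldType.

Local Notation "x %:F" := (@FracField.tofrac _ x) : ring_scope.

Lemma fraction_coprime (a : ratfun F) : exists n d : {poly F},
  [/\ d != 0, coprimep n d & a * d%:F = n%:F].
Proof.
have [n [d [nzd Da]]] : exists n d : {poly F}, d != 0 /\ a * d%:F = n%:F.
  elim/quotW: a => x; exists \n_x, \d_x; split; first exact: denom_ratioP.
  unlock FracField.tofrac; rewrite -[LHS]FracField.pi_mul.
  apply/eqmodP=> /=; rewrite FracField.equivfE /FracField.mulf.
  by rewrite !numden_Ratio ?mulr1 ?oner_eq0 ?denom_ratioP // mulrC.
have nzg : gcdp n d != 0 by rewrite gcdp_eq0 negb_and nzd orbT.
exists (n %/ gcdp n d), (d %/ gcdp n d); split.
- by rewrite dvdp_div_eq0 ?dvdp_gcdr.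
- by rewrite coprimep_div_gcd // nzd orbT.
- apply: (mulIf (x := (gcdp n d)%:F)); first by rewrite tofrac_eq0.
  by rewrite -mulrA -!tofracM !divpK ?dvdp_gcdl ?dvdp_gcdr.
Qed.

(** The rational root test: a reduced denominator divides a power of the numerator, hence is
    constant. *)
Lemma polynomials_integrally_closed (a : ratfun F) :
  integralOver (@FracField.tofrac {poly F}) a -> exists q, a = q%:F.
Proof.
move=> [P monP Pa]; have [n [d [nzd cnd Da]]] := fraction_coprime a.
suff dv : d %| 1.
  have : size d == 1%N by rewrite -dvdp1.
  case/size_poly1P=> c nzc Dd; exists (c^-1 *: n).
  have nzcF : c%:P%:F != 0 :> ratfun F by rewrite tofrac_eq0 polyC_eq0.
  apply: (mulIf nzcF); rewrite -Dd Da Dd -tofracM mulrC mul_polyC scalerA.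
  by rewrite mulfV // scale1r.
have [k szP] : exists k, size P = k.+1.
  by exists (size P).-1; rewrite prednK // size_poly_gt0 monic_neq0.
have Pk : P`_k = 1 by move/monicP: monP; rewrite lead_coefE szP.
suff dv : d %| n ^+ k.
  have : coprimep (n ^+ k) d by rewrite coprimep_expl.
  by rewrite coprimep_sym => /(Gauss_dvdpl 1) <-; rewrite mul1r.
have E : n ^+ k = - d * \sum_(i < k) P`_i * n ^+ i * d ^+ (k - i.+1).
  apply/eqP; rewrite -subr_eq0 mulNr opprK -(tofrac_eq0 (_ + _)).
  rewrite tofracD tofracM tofracXn raddf_sum /= mulr_sumr.
  have /eqP := Pa; rewrite horner_coef size_map_poly_id0; last first.
    by rewrite (monicP monP) tofrac1 oner_eq0.
  rewrite szP big_ord_recr /= coef_map /= Pk tofrac1 mul1r addrC.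
  move/(congr1 (fun z => z * d%:F ^+ k)); rewrite mul0r mulrDl -exprMn Da => {2}<-.
  rewrite mulr_suml; apply/eqP; congr (_ + _); apply: eq_bigr => i _.
  rewrite coef_map /= -mulrA !tofracM !tofracXn -Da exprMn.
  have -> : d%:F ^+ k = d%:F ^+ i * (d%:F * d%:F ^+ (k - i.+1)).
    by rewrite -exprS -exprD; congr (_ ^+ _); have := ltn_ord i; lia.
  by ring.
by rewrite E mulNr dvdpNr dvdp_mulr.
Qed.

Variable L : fieldExtType (ratfun F).

(** The variable of [{poly F}] is t here, so [polyL L 'X] is the element t of [L]. *)
Definition polyL (q : {poly F}) : L := (@FracField.tofrac {poly F} q)%:A.

HB.instance Definition _ := GRing.RMorphism.copy polyL
  (in_alg L \o @FracField.tofrac {poly F}).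

HB.instance Definition _ := GRing.RMorphism.copy (@constF F L)
  (polyL \o polyC).

Lemma polyL_eq0 q : (polyL q == 0) = (q == 0).
Proof. by rewrite -[polyL q]/(in_alg L q%:F) fmorph_eq0 tofrac_eq0. Qed.

Lemma polyL_inj : injective polyL.
Proof.
move=> q r eq_qr; apply/eqP; rewrite -subr_eq0 -polyL_eq0 rmorphB /= eq_qr.
by rewrite subrr.
Qed.

Lemma polyL_mem1 q : polyL q \in 1%VS.
Proof. by rewrite rpredZ ?mem1v. Qed.

Lemma integral_mem1 (y : L) : integralOver polyL y -> y \in 1%VS ->
  exists q, y = polyL q.
Proof.
case=> P monP Py /vlineP[a Dy].
have [|q Da] := @polynomials_integrally_closed a; last by exists q; rewrite Dy Da.
exists P => //; move: Py; rewrite Dy (map_poly_comp (in_alg L)).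
by rewrite fmorph_root.
Qed.

Lemma integral_const_poly (y : L) : algebraicOver (@constF F L) y -> integralOver polyL y.
Proof.
move/integral_algebraic => [q mon_q qy]; exists (map_poly polyC q).
  by rewrite monic_map.
by rewrite -map_poly_comp.
Qed.

Lemma algebraic_polyL q : algebraicOver (@constF F L) (polyL q) -> exists c, q = c%:P.
Proof.
case=> r nzr; rewrite (eq_map_poly (g := polyL \o polyC)) // map_poly_comp.
rewrite /root horner_map polyL_eq0 -[_.[q]]/(r \Po q) => /eqP rq0.
have [szq|szq] := leqP (size q) 1; first by exists q`_0; apply: size1_polyC.
have /eqP : ((size r).-1 * (size q).-1 = 0)%N by rewrite -size_comp_poly rq0 size_poly0.
rewrite muln_eq0 -!subn1 !subn_eq0 (leqNgt (size q)) szq orbF => szr.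
move: rq0; rewrite (size1_polyC szr) comp_polyC => /eqP.
by rewrite polyC_eq0 -polyC_eq0 -size1_polyC // (negPf nzr).
Qed.

Lemma constant_mem1 (y : L) : algebraicOver (@constF F L) y -> y \in 1%VS ->
  exists c, y = constF L c.
Proof.
move=> alg_y y1; have [q Dy] := integral_mem1 (integral_const_poly alg_y) y1.
by rewrite Dy in alg_y *; have [c ->] := algebraic_polyL alg_y; exists c.
Qed.

End RationalFunctions.

(** * Places over t = 0 *)

Section SymmetricSpecialization.

Lemma rmorph_mmap n (R : nzRingType) (A B : comNzRingType) (psi : {rmorphism A -> B})
    (f : {rmorphism R -> A}) (h : 'I_n -> A) (p : {mpoly R[n]}) :
  psi (mmap f h p) = mmap (psi \o f) (psi \o h) p.
Proof.
rewrite /mmap rmorph_sum /=; apply: eq_bigr => m _; rewrite rmorphM /mmap1.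
by rewrite rmorph_prod; congr (_ * _); apply: eq_bigr => i _; rewrite rmorphXn.
Qed.

Lemma eq_mmap n (R A : nzRingType) (f g : R -> A) (h k : 'I_n -> A) (p : {mpoly R[n]}) :
  f =1 g -> h =1 k -> mmap f h p = mmap g k p.
Proof.
move=> eq_fg eq_hk; apply: eq_bigr => m _; rewrite eq_fg /mmap1.
by congr (_ * _); apply: eq_bigr => i _; rewrite eq_hk.
Qed.

Lemma mmap_msym n (R A : comNzRingType) (f : {rmorphism R -> A}) (h : 'I_n -> A)
    (s : 'S_n) (p : {mpoly R[n]}) :
  mmap f h (msym s p) = mmap f (h \o s) p.
Proof.
rewrite /msym (rmorph_mmap (mmap f h)).
by apply: eq_mmap => [a|i] /=; rewrite ?mmapC // mmapX mmap1U.
Qed.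

Lemma mmap_mesym n (R : comNzRingType) (A : idomainType) (f : {rmorphism R -> A})
    (cs : n.-tuple A) (P : {poly R}) (k : nat) : (k <= n)%N ->
    map_poly f P = \prod_(c <- cs) ('X - c%:P) ->
  mmap f (tnth cs) (mesym n R k) = f ((-1) ^+ k * P`_(n - k)).
Proof.
move=> lekn DP; have := mroots_coeff cs (Ordinal (lekn : k < n.+1)%N) => /=.
rewrite -DP coef_map rmorphM /= => ->; rewrite rmorphXn rmorphN1 mulrA -exprMn mulrNN.
rewrite mulr1 expr1n mul1r /mesym !rmorph_sum /=; apply: eq_bigr => i _.
by rewrite !rmorph_prod /=; apply: eq_bigr => j _; rewrite mmapX mmap1U mevalXU.
Qed.

(** [S] is a polynomial in the elementary symmetric ones, whose values at either tuple of roots are,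
    up to sign, the images of the coefficients of the same [P]. *)
Lemma symmetric_specialization n (R : comNzRingType) (A : idomainType) (B : idomainType)
    (f : {rmorphism R -> A}) (g : {rmorphism R -> B})
    (cs : n.-tuple A) (ds : n.-tuple B) (P : {poly R}) (S : {mpoly R[n]}) :
    map_poly f P = \prod_(c <- cs) ('X - c%:P) ->
    map_poly g P = \prod_(d <- ds) ('X - d%:P) -> S \is symmetric ->
  exists r, mmap f (tnth cs) S = f r /\ mmap g (tnth ds) S = g r.
Proof.
move=> Df Dg /sym_fundamental[t [<- _]].
pose e (i : 'I_n) := (-1) ^+ i.+1 * P`_(n - i.+1).
have main (C : idomainType) (h : {rmorphism R -> C}) (bs : n.-tuple C) :
    map_poly h P = \prod_(b <- bs) ('X - b%:P) ->
    mmap h (tnth bs) (t \mPo [tuple mesym n R i.+1 | i < n]) = h (mmap idfun e t).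
  move=> Dh; rewrite /comp_mpoly (rmorph_mmap (mmap h (tnth bs))).
  rewrite (rmorph_mmap h); apply: eq_mmap => [a|i] /=; first by rewrite mmapC.
  by rewrite tnth_mktuple (mmap_mesym _ Dh).
by exists (mmap idfun e t); rewrite !main.
Qed.

(* If every permutation of the roots ds violated some relation Q s between the
   roots cs, the symmetrized product of the polynomial \sum_s Y^s Q s would vanish
   at cs but not at ds. The variable Y keeps the Q s from cancelling each other. *)
Lemma specialize_roots n (R : idomainType) (A : fieldType) (B : fieldType)
    (f : {rmorphism R -> A}) (g : {rmorphism R -> B})
    (cs : n.-tuple A) (ds : n.-tuple B) (P : {poly R}) :
    injective f -> map_poly f P = \prod_(c <- cs) ('X - c%:P) ->
    map_poly g P = \prod_(d <- ds) ('X - d%:P) ->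
  exists s : 'S_n, forall Q : {mpoly R[n]},
    mmap f (tnth cs) Q = 0 -> mmap g (tnth ds \o s) Q = 0.
Proof.
move=> inj_f Df Dg; apply: NNPP => no_s.
have /fin_all_exists2[Q Q0 Qnz] (s : 'S_n) : exists2 Q : {mpoly R[n]},
    mmap f (tnth cs) Q = 0 & mmap g (tnth ds \o s) Q != 0.
  apply: NNPP => noQ; apply: no_s; exists s => Q fQ0.
  by apply/eqP/negPn/negP=> gQ; apply: noQ; exists Q.
pose QY : {mpoly {poly R}[n]} :=
  \sum_(s : 'S_n) ('X^(enum_rank s))%:MP * map_mpoly polyC (Q s).
have evQY (C : fieldType) (h : {rmorphism R -> C}) (v : 'I_n -> C) :
    mmap (map_poly h) (polyC \o v) QY =
    \sum_(s : 'S_n) (mmap h v (Q s)) *: 'X^(enum_rank s).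
  rewrite /QY rmorph_sum /=; apply: eq_bigr => s _.
  rewrite rmorphM /= mmapC /= rmorphXn /= map_polyX mulrC -mul_polyC; congr (_ * _).
  rewrite /map_mpoly (rmorph_mmap (mmap (map_poly h) (polyC \o v))).
  rewrite (rmorph_mmap (@polyC C)); apply: eq_mmap => [a|i] /=.
    by rewrite mmapC /= map_polyC.
  by rewrite mmapX mmap1U.
pose S := \prod_(s : 'S_n) msym s QY.
have symS : S \is symmetric.
  apply/issymP=> s; rewrite /S rmorph_prod /= [RHS](reindex_inj (mulIg s)) /=.
  by apply: eq_bigr => t _; rewrite msymMm.
pose csP := [tuple of map polyC cs]; pose dsP := [tuple of map polyC ds].
have tnthC (C : fieldType) (bs : n.-tuple C) :
    tnth [tuple of map (@polyC C) bs] =1 polyC \o tnth bs.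
  by move=> i; rewrite tnth_map.
have mapY (C : fieldType) (h : {rmorphism R -> C}) (bs : n.-tuple C) :
    map_poly h P = \prod_(b <- bs) ('X - b%:P) ->
    map_poly (map_poly h) (map_poly polyC P) =
      \prod_(b <- map polyC bs) ('X - b%:P).
  move=> Dh; rewrite big_map -map_poly_comp.
  rewrite (eq_map_poly (g := polyC \o h)); last by move=> a /=; rewrite map_polyC.
  rewrite map_poly_comp Dh rmorph_prod /=; apply: eq_bigr => b _.
  by rewrite rmorphB /= map_polyX map_polyC.
have [r [Dr1 Dr2]] := @symmetric_specialization n _ _ _ (map_poly f) (map_poly g)
  csP dsP _ S (mapY _ _ _ Df) (mapY _ _ _ Dg) symS.
have r0 : r = 0.
  have : map_poly f r = 0.
    rewrite -Dr1 (eq_mmap _ (fun=> erefl) (tnthC _ cs)) /S rmorph_prod /=.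
    rewrite (bigD1 1%g) //= msym1m evQY big1 ?mul0r // => s _.
    by rewrite Q0 scale0r.
  move=> fr0; apply/polyP=> i; apply: inj_f.
  by rewrite -coef_map fr0 !coef0 rmorph0.
move: Dr2; rewrite r0 rmorph0 (eq_mmap _ (fun=> erefl) (tnthC _ ds)) /S rmorph_prod /=.
move/eqP/prodf_eq0=> [s _]; rewrite mmap_msym.
rewrite (eq_mmap _ (fun=> erefl) (k := polyC \o (tnth ds \o s))) // evQY.
move/eqP/(congr1 (fun q : {poly B} => q`_(enum_rank s))).
rewrite coef0 coef_sum (bigD1 s) //= coefZ coefXn eqxx mulr1 big1 ?addr0.
  by move/eqP; rewrite (negPf (Qnz s)).
move=> t neq_ts; rewrite coefZ coefXn; case: eqP => [/ord_inj/enum_rank_inj eq_st|_].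
  by rewrite eq_st eqxx in neq_ts.
by rewrite mulr0.
Qed.

End SymmetricSpecialization.

Section Places.

Variables (F : fieldType) (L : splittingFieldType (ratfun F)).
Hypothesis galL : galois 1 {:L}.
Local Notation G := ('Gal({:L} / 1%AS))%g.
Local Notation integral := (integralOver (@polyL F L)).

Lemma gal_fixed_mem1 (y : L) : (forall s, s \in G -> s y = y) -> y \in 1%VS.
Proof.
move=> fix_y; have /galois_fixedField<- := galL.
by apply/fixedFieldP => //; apply: memvf.
Qed.

Lemma gal_mem1 s (y : L) : s \in G -> y \in 1%VS -> s y = y.
Proof. by move=> Gs y1; apply: (fixed_gal (sub1v _) Gs). Qed.

Lemma gal_polyL s q : s \in G -> s (polyL L q) = polyL L q.
Proof. by move=> Gs; rewrite (gal_mem1 Gs) ?polyL_mem1. Qed.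

Lemma gal_map_polyL s (P : {poly {poly F}}) : s \in G ->
  map_poly s (map_poly (@polyL F L) P) = map_poly (@polyL F L) P.
Proof. by move=> Gs; apply/polyP=> i; rewrite !coef_map /= gal_polyL. Qed.

Lemma gal_integral s y : s \in G -> integral y -> integral (s y).
Proof.
move=> Gs [P monP Py]; exists P => //.
by rewrite -(gal_map_polyL P Gs) rmorph_root.
Qed.

Lemma integral_ring : is_subring integral.
Proof.
by split=> [|x y|x y]; [apply: integral1 | apply: integral_sub | apply: integral_mul].
Qed.

Lemma invariant_integral_poly (P : {poly L}) :
    (forall s, s \in G -> map_poly s P = P) -> coefs_in integral P ->
  exists P0 : {poly {poly F}}, map_poly (@polyL F L) P0 = P.
Proof.
move=> fixP intP; have /fin_all_exists[q Dq] (i : 'I_(size P)) : exists q, P`_i = polyL L q.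
  apply: integral_mem1 => //; apply: gal_fixed_mem1 => s Gs.
  by have := congr1 (fun Q : {poly L} => Q`_i) (fixP s Gs); rewrite coef_map.
exists (\poly_(i < size P) if insub i is Some j then q j else 0).
apply/polyP=> i; rewrite coef_map coef_poly /=; case: ltnP => [lti|gei].
  by rewrite insubT -Dq.
by rewrite rmorph0 nth_default.
Qed.

(* A homomorphism lam from a Galois-stable ring A of integral elements to a field,
   extending evaluation of polynomials at t = 0. *)
Record is_place (kappa : fieldType) (iota : {rmorphism F -> kappa})
    (A : L -> Prop) (lam : L -> kappa) : Prop := {
  place_ring : is_subring A;
  place_integral : forall y, A y -> integral y;
  place_gal : forall s y, s \in G -> A y -> A (s y);
  place_poly : forall q, A (polyL L q);
  place_polyE : forall q, lam (polyL L q) = iota q.[0];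
  placeB : forall x y, A x -> A y -> lam (x - y) = lam x - lam y;
  placeM : forall x y, A x -> A y -> lam (x * y) = lam x * lam y }.

(** Stands for the choice of a prime above t = 0. The ring [A] is generated over F[t] by the
    conjugates of the elements of [zs]. These are the roots of a monic polynomial over F[t], and
    [specialize_roots] sends them, compatibly with all their relations, to the roots of its value at
    t = 0. *)
Lemma place_exists (zs : seq L) : (forall z, z \in zs -> integral z) ->
  exists kappa iota A lam,
    @is_place kappa iota A lam /\ forall z, z \in zs -> A z.
Proof.
move=> int_zs; pose xs := [seq (s : gal_of {:L}) z | z <- zs, s <- enum G].
have int_xs x : x \in xs -> integral x.
  case/allpairsP=> [[z s]] /= [zs_z]; rewrite mem_enum => Gs ->.
  exact/gal_integral/int_zs.
pose fx := \prod_(x <- xs) ('X - x%:P).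
have gal_xs s x : s \in G -> x \in xs -> s x \in xs.
  move=> Gs /allpairsP[[z u] /= [zs_z]]; rewrite mem_enum => Gu ->.
  apply/allpairsP; exists (z, (u * s)%g) => /=.
  by rewrite mem_enum groupM // galM ?memvf.
have fix_fx s : s \in G -> map_poly s fx = fx.
  move=> Gs; rewrite /fx /xs !big_allpairs_dep rmorph_prod /=; apply: eq_bigr => z _.
  rewrite rmorph_prod /= !big_enum /= [RHS](reindex_inj (mulIg s)) /=.
  apply: eq_big => [u|u Gu]; first by rewrite groupMr.
  by rewrite rmorphB /= map_polyX map_polyC /= galM ?memvf.
have int_fx : coefs_in integral fx.
  by rewrite /fx big_seq; apply: (coefs_in_prod_XsubC integral_ring).
have [P0 DP0] := invariant_integral_poly fix_fx int_fx.
have monP0 : P0 \is monic.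
  have := monic_prod_XsubC xs xpredT id; rewrite -/fx -DP0 !monicE.
  rewrite lead_coef_map_inj ?rmorph0 //; last exact: polyL_inj.
  by move/eqP=> E; apply/eqP/(@polyL_inj F L); rewrite E rmorph1.
pose p0 : {poly F} := map_poly (horner_eval 0) P0.
have monp0 : p0 \is monic by rewrite monic_map.
have [K [as_ Das _]] := splitting_field_exists (monic_neq0 monp0).
pose iota : {rmorphism F -> K} := in_alg K.
have Dp0 : map_poly iota p0 = \prod_(a <- as_) ('X - a%:P).
  apply/eqP; rewrite -eqp_monic ?monic_map // monic_prod_XsubC //.
have sz_as : size as_ == size xs.
  have := size_prod_XsubC xs id; rewrite -/fx -DP0 size_map_inj_poly ?rmorph0 //; last exact: polyL_inj.
  have := size_prod_XsubC as_ id; rewrite -Dp0 size_map_poly size_map_poly_id0.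
    by move=> -> [->].
  by rewrite (monicP monP0) rmorph1 oner_eq0.
pose cs := in_tuple xs; pose ds : (size xs).-tuple K := Tuple sz_as.
pose ev : {rmorphism {mpoly {poly F}[size xs]} -> L} := mmap (@polyL F L) (tnth cs).
pose spec : {rmorphism {poly F} -> K} := iota \o horner_eval 0.
have [||s ev_spec] := @specialize_roots _ _ _ _ (@polyL F L) spec cs ds P0 (@polyL_inj F L).
- by rewrite DP0.
- by rewrite (map_poly_comp iota) -/p0 Dp0.
pose Lam : {rmorphism {mpoly {poly F}[size xs]} -> K} := mmap spec (tnth ds \o s).
pose A y := exists Q, y = ev Q.
(* [lam] evaluates a chosen expression of [y] in the conjugates. Two expressions differ by a
   relation, which the choice of [s] preserves at t = 0, so the choice does not matter. *)
pose lam (y : L) := Lam (epsilon (inhabits 0) (fun Q => y = ev Q)).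
have lamE Q : lam (ev Q) = Lam Q.
  rewrite /lam; set Q' := epsilon _ _.
  have DQ' : ev Q = ev Q' by apply: (epsilon_spec (inhabits 0) (fun Q' => ev Q = ev Q')); exists Q.
  have /ev_spec : mmap (@polyL F L) (tnth cs) (Q' - Q) = 0.
    by rewrite rmorphB; apply/eqP; rewrite subr_eq0; apply/eqP/esym.
  by rewrite rmorphB => /eqP; rewrite subr_eq0 => /eqP.
have evC q : polyL L q = ev q%:MP by rewrite /= mmapC.
have evX i : tnth cs i = ev 'X_i by rewrite /= mmapX mmap1U.
exists K, iota, A, lam; split; last first.
  move=> z zs_z; have /tnthP[i ->] : z \in cs.
    by apply/allpairsP; exists (z, 1%g); rewrite mem_enum group1 gal_id.
  by exists 'X_i; rewrite -evX.
split.
- split=> [|_ _ [Q ->] [R ->]|_ _ [Q ->] [R ->]].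
  + by exists 1; rewrite rmorph1.
  + by exists (Q - R); rewrite rmorphB.
  + by exists (Q * R); rewrite rmorphM.
- move=> _ [Q ->]; have idI := subring_ideal integral_ring.
  have [_ _ IM] := integral_ring.
  apply: (ideal_sum idI) => m _; apply: IM; first exact: integral_id.
  apply: (subring_prod integral_ring) => i _; apply: (subring_exp integral_ring).
  exact/int_xs/mem_tnth.
- move=> u _ Gu [Q ->].
  have /fin_all_exists[v Dv] i : exists j, u (tnth cs i) = tnth cs j.
    by apply/tnthP/gal_xs => //; apply: mem_tnth.
  exists (mmap (@mpolyC _ _) (fun i => 'X_(v i)) Q).
  rewrite [RHS](rmorph_mmap (mmap (@polyL F L) (tnth cs))) /=.
  rewrite (rmorph_mmap u); apply: eq_mmap => [a|i] /=.
    by rewrite mmapC gal_polyL.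
  by rewrite Dv evX.
- by move=> q; exists q%:MP.
- by move=> q; rewrite evC lamE /= mmapC.
- by move=> _ _ [Q ->] [R ->]; rewrite -rmorphB !lamE rmorphB.
- by move=> _ _ [Q ->] [R ->]; rewrite -rmorphM !lamE rmorphM.
Qed.

End Places.

(** * Nontrivial inertia at a place over t = 0 *)

Section Inertia.

Variables (F : fieldType) (L : splittingFieldType (ratfun F)).
Hypothesis galL : galois 1 {:L}.
Local Notation G := ('Gal({:L} / 1%AS))%g.
Variables (kappa : fieldType) (iota : {rmorphism F -> kappa}).
Variables (A : L -> Prop) (lam : L -> kappa).
Hypothesis pl : is_place iota A lam.

Let ringA : is_subring A := place_ring pl.
Let idA : is_ideal A A := subring_ideal ringA.

Lemma place_A0 : A 0. Proof. by case: idA. Qed.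

Lemma place0 : lam 0 = 0.
Proof.
have A1 : A 1 by case: ringA.
by rewrite -(subrr 1) (placeB pl) // subrr.
Qed.

Lemma place1 : lam 1 = 1.
Proof. by rewrite -(rmorph1 (@polyL F L)) (place_polyE pl) hornerC rmorph1. Qed.

Lemma placeD x y : A x -> A y -> lam (x + y) = lam x + lam y.
Proof.
move=> Ax Ay; have A0 := place_A0.
have AN : A (0 - y) by case: idA => _ AB _; apply: AB.
have -> : x + y = x - (0 - y) by rewrite sub0r opprK.
by rewrite !(placeB pl) // place0 sub0r opprK.
Qed.

Lemma place_sum (I : Type) (r : seq I) (P : pred I) (f : I -> L) :
    (forall i, P i -> A (f i)) ->
  lam (\sum_(i <- r | P i) f i) = \sum_(i <- r | P i) lam (f i).
Proof.
move=> Af; suff [] : A (\sum_(i <- r | P i) f i) /\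
    lam (\sum_(i <- r | P i) f i) = \sum_(i <- r | P i) lam (f i) by [].
elim/big_rec2: _ => [|i x y Pi [Ay Dy]]; first by rewrite place0; split; first exact: place_A0.
split; first by apply: (ideal_add idA) => //; apply: Af.
by rewrite placeD ?Dy //; apply: Af.
Qed.

Lemma place_prod (I : Type) (r : seq I) (P : pred I) (f : I -> L) :
    (forall i, P i -> A (f i)) ->
  lam (\prod_(i <- r | P i) f i) = \prod_(i <- r | P i) lam (f i).
Proof.
move=> Af; suff [] : A (\prod_(i <- r | P i) f i) /\
    lam (\prod_(i <- r | P i) f i) = \prod_(i <- r | P i) lam (f i) by [].
have [A1 _ AM] := ringA.
elim/big_rec2: _ => [|i x y Pi [Ay Dy]]; first by rewrite place1.
split; first by apply: AM => //; apply: Af.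
by rewrite (placeM pl) ?Dy //; apply: Af.
Qed.

Lemma place_constF c : lam (constF L c) = iota c.
Proof. by rewrite (place_polyE pl) hornerC. Qed.

Lemma place_exp x n : A x -> lam (x ^+ n) = lam x ^+ n.
Proof.
move=> Ax; elim: n => [|n IHn]; first by rewrite !expr0 place1.
by rewrite !exprS (placeM pl) ?IHn //; apply: (subring_exp ringA).
Qed.

Lemma place_hornerA (q : {poly F}) x : A x -> A (map_poly (@constF F L) q).[x].
Proof.
move=> Ax; apply: (coefs_in_horner ringA idA) => // i.
by rewrite coef_map; apply: (place_poly pl).
Qed.

Lemma place_horner (q : {poly F}) x : A x ->
  lam (map_poly (@constF F L) q).[x] = (map_poly iota q).[lam x].
Proof.
move=> Ax; have [_ _ AM] := ringA.
have Ai i : A (constF L q`_i * x ^+ i).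
  by apply: AM; [apply: (place_poly pl) | apply: (subring_exp ringA)].
rewrite !horner_coef !size_map_poly place_sum => [|i _]; last by rewrite coef_map; apply: Ai.
apply: eq_bigr => i _; rewrite !coef_map /= (placeM pl).
- by rewrite place_constF place_exp.
- exact: (place_poly pl).
- exact: (subring_exp ringA).
Qed.

(* If no nontrivial element fixes lam, there are a_i, b_i in A with
   \sum_i a_i s(b_i) = 0 for s != 1 and lam (\sum_i a_i b_i) != 0. Then
   (\sum_i a_i b_i) y = \sum_i a_i Tr(b_i y) is divisible by t in A, because the
   traces are polynomials vanishing at t = 0; cancelling y in t h = x y yields
   lam h = 0. *)
Lemma inertia_exists (x y h : L) : A x -> A y -> A h ->
    polyL L 'X * h = x * y -> lam h != 0 -> lam x = 0 ->
    (forall s, s \in G -> lam (s y) = 0) ->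
  exists s, [/\ s \in G, s != 1%g & forall z, A z -> lam (s z) = lam z].
Proof.
move=> Ax Ay Ah Dth nzh x0 y0; apply: NNPP => no_s.
have [A1 AB AM] := ringA; have AD := ideal_add idA.
have /fin_all_exists[b Db] (s : gal_of {:L}) : exists b, A b /\
    (s \in G -> s != 1%g -> lam (s b) != lam b).
  apply: NNPP => no_b; case: (classic (s \in G /\ s != 1%g)) => [[Gs s1]|nGs]; last first.
    by case: no_b; exists 0; split=> [|Gs s1]; [apply: place_A0 | case: nGs].
  apply: no_s; exists s; split=> // z Az; apply/eqP/negPn/negP=> nsz.
  by apply: no_b; exists z; split.
(* Expands, in the tensor square of [A], the product over [gs] of the differences between [b g] on
   the right and [g (b g)] on the left. Applying [u] to the right-hand factors kills it for every
   [u] in [gs], while for [u = 1] each factor has a nonzero image under [lam]. *)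
have tensor (gs : seq (gal_of {:L})) : {subset gs <= G} ->
    exists ab : seq (L * L), (forall c, c \in ab -> A c.1 /\ A c.2) /\
      forall u, u \in G -> \sum_(c <- ab) c.1 * u c.2 = \prod_(g <- gs) (u (b g) - g (b g)).
  elim: gs => [|g gs IHgs] sgsG.
    exists [:: (1, 1)]; split=> [c|u Gu]; first by rewrite inE => /eqP->.
    by rewrite big_seq1 big_nil /= rmorph1 mulr1.
  have [|ab [Aab Dab]] := IHgs; first by move=> i gi; apply: sgsG; rewrite inE gi orbT.
  have Gg : g \in G by apply: sgsG; rewrite mem_head.
  have Ab : A (b g) by case: (Db g).
  exists ([seq (c.1, c.2 * b g) | c <- ab] ++ [seq (- (g (b g)) * c.1, c.2) | c <- ab]).
  split=> [c|u Gu].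
    rewrite mem_cat => /orP[] /mapP[c' /Aab[A1' A2'] ->] /=; split=> //; apply: AM => //.
    by apply: (ideal_opp idA); apply: (place_gal pl).
  rewrite big_cat /= !big_map big_cons -(Dab u Gu) mulr_sumr -big_split /=.
  by apply: eq_bigr => c _; rewrite rmorphM /=; ring.
have [|ab [Aab Dab]] := tensor [seq g <- enum G | g != 1%g].
  by move=> g; rewrite mem_filter mem_enum => /andP[].
pose e := \sum_(c <- ab) c.1 * c.2.
have De : e = \prod_(g <- enum G | g != 1%g) (b g - g (b g)).
  have := Dab 1%g (group1 _); rewrite big_filter => De.
  have -> : e = \sum_(c <- ab) c.1 * (1%g : gal_of {:L}) c.2.
    by apply: eq_bigr => c _; rewrite gal_id.
  by rewrite De; apply: eq_bigr => g _; rewrite gal_id.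
have De0 u : u \in G -> u != 1%g -> \sum_(c <- ab) c.1 * u c.2 = 0.
  move=> Gu u1; rewrite (Dab u Gu); apply/eqP; rewrite prodf_seq_eq0.
  apply/hasP; exists u; last by rewrite subrr eqxx.
  by rewrite mem_filter u1 mem_enum.
have Ae : A e by rewrite /e big_seq; apply: (ideal_sum idA) => c /Aab[]; apply: AM.
have nze : lam e != 0.
  rewrite De big_seq_cond place_prod; last first.
    move=> g /andP[]; rewrite mem_enum => Gg _; have [Ab _] := Db g.
    by apply: AB => //; apply: (place_gal pl).
  rewrite -big_seq_cond prodf_seq_neq0; apply/allP=> g; rewrite mem_enum => Gg.
  apply/implyP=> g1; have [Ab /(_ Gg g1) nb] := Db g.
  rewrite (placeB pl) ?subr_eq0 1?eq_sym //; exact: (place_gal pl).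
pose Tr z := \sum_(u in G) u z.
have TrE : e * y = \sum_(c <- ab) c.1 * Tr (c.2 * y).
  transitivity (\sum_(u in G) (\sum_(c <- ab) c.1 * u c.2) * u y).
    rewrite (bigD1 1%g) ?group1 //= [X in _ + X]big1 ?addr0.
      by rewrite gal_id; congr (_ * _); apply: eq_bigr => c _; rewrite gal_id.
    by move=> u /andP[Gu u1]; rewrite De0 // mul0r.
  rewrite (eq_bigr (fun u : gal_of {:L} => \sum_(c <- ab) c.1 * u c.2 * u y)); last first.
    by move=> u _; rewrite mulr_suml.
  rewrite exchange_big /=; apply: eq_bigr => c _; rewrite mulr_sumr.
  by apply: eq_bigr => u _; rewrite rmorphM mulrA.
have TrX c : A c -> exists2 q, A q & Tr (c * y) = polyL L 'X * q.
  move=> Ac; have Acy : A (c * y) by apply: AM.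
  have ATr u : u \in G -> A (u (c * y)) by move=> Gu; apply: (place_gal pl).
  have [||q Dq] := @integral_mem1 F L (Tr (c * y)).
  - by apply: (place_integral pl); apply: (ideal_sum idA).
  - apply: (gal_fixed_mem1 galL) => s Gs; rewrite /Tr rmorph_sum /=.
    rewrite [RHS](reindex_inj (mulIg s)) /=; apply: eq_big => [u|u Gu].
      by rewrite groupMr.
    by rewrite galM ?memvf.
  have /eqP : iota q.[0] = 0.
    rewrite -(place_polyE pl) -Dq place_sum // big1 // => u Gu.
    rewrite rmorphM (placeM pl) ?y0 ?mulr0 //; exact: (place_gal pl).
  rewrite fmorph_eq0 -/(root q 0) => /factor_theorem[r Dr].
  exists (polyL L r); first exact: (place_poly pl).
  by rewrite Dq Dr subr0 mulrC rmorphM.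
have [a Aa Da] : exists2 a, A a & e * y = polyL L 'X * a.
  rewrite TrE; elim: ab Aab {tensor Dab e De De0 Ae nze TrE} => [|c ab IHab] Aab.
    by exists 0; [apply: place_A0 | rewrite big_nil mulr0].
  have [|a Aa Da] := IHab; first by move=> d abd; apply: Aab; rewrite inE abd orbT.
  have [Ac1 Ac2] := Aab _ (mem_head _ _); have [q Aq Dq] := TrX _ Ac2.
  exists (c.1 * q + a); first by apply: AD => //; apply: AM.
  by rewrite big_cons Da Dq; ring.
have nzy : y != 0.
  apply: contraNneq nzh => Dy; move/eqP: Dth; rewrite Dy mulr0 mulf_eq0.
  by rewrite polyL_eq0 polyX_eq0 /= => /eqP->; rewrite place0.
have : e * h = a * x.
  apply: (mulIf nzy); rewrite mulrAC Da -[a * x * y]mulrA -Dth; ring.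
move/(congr1 lam); rewrite !(placeM pl) // x0 mulr0 => /eqP.
by rewrite mulf_eq0 (negPf nze) (negPf nzh).
Qed.

End Inertia.

(** * The cover and its Galois group *)

(** Roots are adjoined one at a time; a root simple over [E] stays so over a larger field, and no
    step creates a new value. *)
Lemma value_adjoin_seq (K0 : fieldType) (L : fieldExtType K0) (w : L -> int)
    (wM : forall x y : L, x != 0 -> y != 0 -> w (x * y) = w x + w y)
    (wD : forall x y : L, x != 0 -> y != 0 -> x + y != 0 ->
       Num.min (w x) (w y) <= w (x + y)) (E : {subfield L}) (zs : seq L) :
    (forall z, z \in zs -> vint w z /\ exists P,
       [/\ coefs_in (fun a => a \in E /\ vint w a) P, P.[z] = 0
         & ~~ vmax w P^`().[z]]) ->
  forall y, y \in <<E & zs>>%VS -> y != 0 ->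
  exists a, [/\ a \in E, a != 0 & w a = w y].
Proof.
elim: zs E => [|z zs IHzs] E Pzs y.
  by rewrite Fadjoin_nil => Ey nzy; exists y.
rewrite adjoin_cons => Ey nzy.
have [z' zs_z'|a [Ea nza wa]] := IHzs <<E; z>>%AS _ y Ey nzy.
  have [|Oz' [P [OP Pz' P'z']]] := Pzs z'; first by rewrite inE zs_z' orbT.
  split=> //; exists P; split=> // i; have [Ei Oi] := OP i.
  by split=> //; apply: subvP_adjoin.
have [Oz [P [OP Pz P'z]]] := Pzs z (mem_head _ _).
have ringE : is_subring (fun b => b \in E).
  by split=> [|b c|b c]; [apply: rpred1 | apply: rpredB | apply: rpredM].
have [||b [Eb nzb wb]] := @simple_root_value L w wM wD (fun b => b \in E) ringE
  _ z Oz P a OP Pz P'z _ nza.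
- by move=> b; rewrite rpredV.
- by have /Fadjoin_polyP[q Eq ->] := Ea; exists q => // i; apply/polyOverP.
by exists b; rewrite wb wa.
Qed.

Section TheCover.

Variables (F : fieldType) (p m : nat) (g h v : {poly F}).
Hypothesis rd : ramification_data p m g h v.
Variable L : splittingFieldType (ratfun F).

Local Notation cL := (@constF F L).
Local Notation T := (polyL L 'X).
Local Notation gL := (map_poly cL g).
Local Notation hL := (map_poly cL h).
Local Notation WL := (map_poly cL (wronskian g h)).

(** The scalar ['X] is the parameter t; the unknown is the outer variable. *)
Definition cover_poly : {poly {poly F}} := map_poly polyC g - 'X *: map_poly polyC h.

Local Notation fL := (map_poly (@polyL F L) cover_poly).

Lemma cover_polyE : fL = gL - T *: hL.
Proof. by rewrite rmorphB /= map_polyZ -!map_poly_comp. Qed.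

Lemma monic_cover : cover_poly \is monic.
Proof.
have szg : size (map_poly polyC g) = m.+1.
  by rewrite (size_map_inj_poly (@polyC_inj _)) ?rmorph0 // (rd_size rd).
have ltgh : (size (- ('X *: map_poly polyC h)) < size (map_poly polyC g))%N.
  rewrite szg size_polyN (leq_ltn_trans (size_scale_leq _ _)) //.
  by rewrite (size_map_inj_poly (@polyC_inj _)) ?rmorph0 // ltnS (rd_size_h rd).
rewrite monicE /cover_poly lead_coefDl // (lead_coef_map_inj (@polyC_inj _)) ?rmorph0 //.
by rewrite (monicP (rd_monic rd)).
Qed.

Lemma size_cover : size cover_poly = m.+1.
Proof.
have szg : size (map_poly polyC g) = m.+1.
  by rewrite (size_map_inj_poly (@polyC_inj _)) ?rmorph0 // (rd_size rd).
rewrite /cover_poly size_polyDl // szg size_polyN (leq_ltn_trans (size_scale_leq _ _)) //.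
by rewrite (size_map_inj_poly (@polyC_inj _)) ?rmorph0 // ltnS (rd_size_h rd).
Qed.

Lemma wronskianL : WL = gL^`() * hL - gL * hL^`().
Proof. by rewrite /wronskian rmorphB !rmorphM /= !deriv_map. Qed.

(** The wronskian is alternating and t is a constant for the derivation. With [a = 1] here, and
    [a = 1 / t] in the version with [g], the same [WL] controls the multiple roots at finite and at
    infinite t. *)
Lemma wronskian_h a : (a *: fL)^`() * hL - (a *: fL) * hL^`() = a *: WL.
Proof.
by rewrite cover_polyE wronskianL derivZ derivB derivZ -!mul_polyC; ring.
Qed.

Lemma wronskian_g a : (a *: fL)^`() * gL - (a *: fL) * gL^`() = (a * T) *: WL.
Proof.
by rewrite cover_polyE wronskianL derivZ derivB derivZ -!mul_polyC polyCM; ring.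
Qed.

Lemma algebraic_horner (q : {poly F}) y :
  algebraicOver cL y -> algebraicOver cL (map_poly cL q).[y].
Proof.
move/integral_algebraic=> int_y; apply/integral_algebraic/integral_horner => //.
by apply/integral_poly=> i; rewrite coef_map; apply: integral_id.
Qed.

Lemma T_transcendental : ~ algebraicOver cL T.
Proof.
move/algebraic_polyL=> [c DX]; have := size_polyX F; rewrite DX.
by have := size_polyC_leq1 c; move: (size _) => k; lia.
Qed.

Lemma cover_root_h_neq0 y : root fL y -> hL.[y] != 0.
Proof.
move=> fy; apply/negP=> /eqP hy; have gy : root gL y.
  move: fy; rewrite cover_polyE /root !hornerE hy mulr0 subr0 //.
have : coprimep gL hL by rewrite coprimep_map (rd_coprime rd).
by move/coprimep_root/(_ gy); rewrite hy eqxx.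
Qed.

Lemma cover_rootE y : root fL y -> T * hL.[y] = gL.[y].
Proof.
rewrite cover_polyE /root !hornerE subr_eq0 => /eqP->; by [].
Qed.

Lemma cover_root_transcendental y : root fL y -> ~ algebraicOver cL y.
Proof.
move=> fy alg_y; apply: T_transcendental.
have -> : T = gL.[y] / hL.[y] by rewrite -cover_rootE // mulfK // cover_root_h_neq0.
by apply: algebraic_div; apply: algebraic_horner.
Qed.

(** A root of f is transcendental over F, since t is a rational function of it. This is the source
    of separability. *)
Lemma cover_root_wronskian_neq0 y : root fL y -> WL.[y] != 0.
Proof.
move=> fy; apply/negP=> Wy; apply: (cover_root_transcendental fy).
by exists (wronskian g h) => //; apply: (rd_wronskian rd).
Qed.

Lemma cover_root_deriv_neq0 y : root fL y -> fL^`().[y] != 0.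
Proof.
move=> fy; have := congr1 (fun q : {poly L} => q.[y]) (wronskian_h 1).
rewrite !scale1r !hornerE (rootP fy) mul0r subr0 => E.
by have := cover_root_wronskian_neq0 fy; rewrite -E mulf_eq0 => /norP[].
Qed.

Variable rs : seq L.
Hypothesis Drs : fL = \prod_(z <- rs) ('X - z%:P).
Hypothesis genL : <<1 & rs>>%VS = {:L}%VS.

Lemma root_coverE y : root fL y = (y \in rs).
Proof. by rewrite Drs root_prod_XsubC. Qed.

Lemma size_cover_roots : size rs = m.
Proof.
have := size_prod_XsubC rs id; rewrite -Drs.
by rewrite (size_map_inj_poly (@polyL_inj F L)) ?rmorph0 // size_cover => -[].
Qed.

Lemma separable_cover : separable_poly fL.
Proof.
have nroot z : z \in rs -> ~~ root fL^`() z.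
  by rewrite -root_coverE => /cover_root_deriv_neq0.
rewrite separable_poly.unlock; move: (fL^`()) nroot => f' nroot; rewrite Drs.
elim: rs nroot => [|z s IHs] nroot; first by rewrite big_nil coprime1p.
rewrite big_cons coprimepMl IHs ?andbT => [|y s_y]; last first.
  by apply: nroot; rewrite inE s_y orbT.
by rewrite coprimep_sym coprimep_XsubC nroot ?mem_head.
Qed.

Lemma uniq_cover_roots : uniq rs.
Proof. by rewrite -separable_prod_XsubC -Drs separable_cover. Qed.

Lemma cover_galois : galois 1 {:L}.
Proof.
apply/splitting_galoisField; exists fL; split; last 1 first.
- by exists rs; rewrite // -Drs eqpxx.
- by apply/polyOverP=> i; rewrite coef_map /= polyL_mem1.
- exact: separable_cover.
Qed.

Local Notation G := ('Gal({:L} / 1%AS))%g.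

Lemma mem_gal (s : gal_of {:L}) : s \in G.
Proof. by rewrite gal_kHom ?sub1v // k1AHom. Qed.

Definition cover_root (i : 'I_m) : L := rs`_i.

Local Notation x := cover_root.

Lemma cover_root_inj : injective x.
Proof.
move=> i j /eqP; rewrite nth_uniq ?size_cover_roots ?ltn_ord ?uniq_cover_roots // => /eqP.
exact: val_inj.
Qed.

Lemma mem_cover_root i : x i \in rs.
Proof. by rewrite mem_nth ?size_cover_roots. Qed.

Lemma cover_root_onto y : y \in rs -> exists i, y = x i.
Proof.
move=> rs_y; have lti : (index y rs < m)%N by rewrite -size_cover_roots index_mem.
by exists (Ordinal lti); rewrite /cover_root nth_index.
Qed.

Lemma cover_poly_factor : fL = \prod_(i : 'I_m) ('X - (x i)%:P).
Proof.
by rewrite Drs (big_nth 0) size_cover_roots big_mkord.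
Qed.

Lemma root_cover_root i : root fL (x i).
Proof. by rewrite root_coverE mem_cover_root. Qed.

Lemma integral_cover_root i : integralOver (@polyL F L) (x i).
Proof. by exists cover_poly; [apply: monic_cover | apply: root_cover_root]. Qed.

Lemma gal_cover_root (s : gal_of {:L}) i : exists j, s (x i) = x j.
Proof.
apply: cover_root_onto; rewrite -root_coverE -(gal_map_polyL _ (mem_gal s)).
exact: (rmorph_root s (root_cover_root i)).
Qed.

Definition gal_fun (s : gal_of {:L}) i : 'I_m := odflt i [pick j | s (x i) == x j].

Lemma cover_root_gal_fun s i : x (gal_fun s i) = s (x i).
Proof.
rewrite /gal_fun; case: pickP => [j /eqP-> //|none].
by have [j Dj] := gal_cover_root s i; have := none j; rewrite Dj eqxx.
Qed.

Lemma gal_fun_inj s : injective (gal_fun s).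
Proof.
move=> i j /(congr1 x); rewrite !cover_root_gal_fun => /fmorph_inj; exact: cover_root_inj.
Qed.

Definition gal_perm s : 'S_m := perm (@gal_fun_inj s).

Lemma cover_root_gal_perm s i : x (gal_perm s i) = s (x i).
Proof. by rewrite permE cover_root_gal_fun. Qed.

Lemma gal_permM : {morph gal_perm : s t / (s * t)%g}.
Proof.
move=> s t; apply/permP=> i; apply: cover_root_inj.
by rewrite permM !cover_root_gal_perm galM ?memvf.
Qed.

Lemma gal_fix_cover_roots (s : gal_of {:L}) : (forall i, s (x i) = x i) -> s = 1%g.
Proof.
move=> fix_s; apply/eqP/gal_eqP=> y _; rewrite gal_id.
have /fixedFieldP : y \in fixedField [set s]; last first.
  by move=> /(_ (memvf _)) /(_ s); rewrite inE eqxx; apply.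
have /subvP : (<<1 & rs>> <= fixedField [set s])%VS.
  apply/Fadjoin_seqP; split; first exact: sub1v.
  move=> _ /cover_root_onto[i ->]; apply/fixedFieldP; first exact: memvf.
  by move=> u; rewrite inE => /eqP->.
by apply; rewrite genL memvf.
Qed.

Lemma gal_perm1 : gal_perm 1%g = 1%g.
Proof. by apply/permP=> i; apply: cover_root_inj; rewrite cover_root_gal_perm gal_id perm1. Qed.

Lemma gal_perm_eq1 s : (gal_perm s == 1%g) = (s == 1%g).
Proof.
apply/eqP/eqP=> [s1|->]; last exact: gal_perm1.
by apply: gal_fix_cover_roots => i; rewrite -cover_root_gal_perm s1 perm1.
Qed.

Canonical gal_perm_morphism := @Morphism _ _ [set: gal_of {:L}] gal_perm
  (in2W gal_permM).

Lemma gal_perm_inj : injective gal_perm.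
Proof.
move=> s t eq_st; apply/eqP; rewrite eq_mulgV1 -gal_perm_eq1.
by rewrite -[gal_perm _]/(gal_perm_morphism _) morphM ?inE // morphV ?inE //= eq_st mulgV.
Qed.

(* Both orbit polynomials lie in F[t][X]. As f has degree 1 in t, one of them is free
   of t, hence divides the coprime polynomials g and h. *)
Lemma gal_perm_transitive i j : exists s, gal_perm s i = j.
Proof.
pose O := [set gal_perm s i | s : gal_of {:L}].
have orbP (S : {set 'I_m}) : (forall s k, (gal_perm s k \in S) = (k \in S)) ->
    exists P : {poly {poly F}}, map_poly (@polyL F L) P = \prod_(k in S) ('X - (x k)%:P).
  move=> stabS; apply: (invariant_integral_poly cover_galois) => [s _|].
    rewrite rmorph_prod /= [RHS](reindex_inj (@perm_inj _ (gal_perm s))) /=.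
    apply: eq_big => [k|k Sk]; first by rewrite stabS.
    by rewrite rmorphB /= map_polyX map_polyC /= cover_root_gal_perm.
  by apply: (coefs_in_prod_XsubC (integral_ring L)) => k _; apply: integral_cover_root.
have stabO s k : (gal_perm s k \in O) = (k \in O).
  apply/imsetP/imsetP=> [[u _ Du]|[u _ ->]]; last first.
    by exists (u * s)%g; rewrite ?inE // gal_permM permM.
  exists (u * s^-1)%g; rewrite ?inE // gal_permM permM -Du -permM -gal_permM mulgV.
  by rewrite gal_perm1 perm1.
have [P1 DP1] := orbP O stabO.
have [P2 DP2] : exists P, map_poly (@polyL F L) P = \prod_(k in ~: O) ('X - (x k)%:P).
  by apply: orbP => s k; rewrite !inE stabO.
have iO : i \in O.
  by apply/imsetP; exists 1%g; rewrite // gal_perm1 perm1.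
have Df : cover_poly = P1 * P2.
  apply: (map_inj_poly (@polyL_inj F L)); first by rewrite rmorph0.
  rewrite rmorphM /= DP1 DP2 cover_poly_factor (bigID (mem O)) /=; congr (_ * _).
  by apply: eq_bigl => k; rewrite inE.
suff /setP/(_ j) : O = setT by rewrite inE => /imsetP[s _ ->]; exists s.
have : swapXY cover_poly = swapXY P1 * swapXY P2 by rewrite Df rmorphM.
rewrite /cover_poly rmorphB /= -mul_polyC rmorphM /= swapXY_polyC !swapXY_map_polyC.
rewrite map_polyX => Es.
have size_swap (Q : {poly {poly F}}) : size (swapXY Q) = 1%N ->
    exists q : {poly F}, Q = q^:P.
  move=> szQ; exists (swapXY Q)`_0; apply: (can_inj (@swapXYK _)).
  by rewrite swapXY_map_polyC -size1_polyC ?szQ.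
have dvd1 (q : {poly F}) (Q : {poly {poly F}}) :
    g%:P - 'X * h%:P = q%:P * Q -> size q = 1%N.
  move=> E; have dvg : q %| g.
    have := congr1 (fun R : {poly {poly F}} => R`_0) E.
    rewrite coefB coefC coefXM coefCM /= subr0 => ->; exact: dvdp_mulr.
  have dvh : q %| h.
    have := congr1 (fun R : {poly {poly F}} => R`_1) E.
    rewrite coefB coefC coefXM coefCM /= coefC /= sub0r => /eqP; rewrite eqr_oppLR => /eqP->.
    by rewrite dvdpNr dvdp_mulr.
  apply/eqP; rewrite -dvdp1; have := rd_coprime rd; rewrite coprimep_def.
  move=> sz1; have : q %| gcdp g h by rewrite dvdp_gcd dvg dvh.
  by move/dvdp_trans; apply; rewrite dvdp1.
have nzE : g%:P - 'X * h%:P != 0 :> {poly {poly F}}.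
  apply/eqP=> /(congr1 (fun R : {poly {poly F}} => R`_0)).
  rewrite coefB coefC coefXM /= subr0 coef0 => /eqP.
  by rewrite (negPf (monic_neq0 (rd_monic rd))).
have nzP12 : swapXY P1 != 0 /\ swapXY P2 != 0.
  by apply/andP; rewrite -negb_or -mulf_eq0 -Es.
have szE : (size (g%:P - 'X * h%:P : {poly {poly F}})%R <= 2)%N.
  apply/leq_sizeP=> k; rewrite coefB coefC coefXM coefC.
  by case: k => [|[|k]] //= _; rewrite subr0.
have [nz1 nz2] := nzP12.
have := szE; rewrite Es size_mul //.
have := size_poly_gt0 (swapXY P1); rewrite nz1 => s1.
have := size_poly_gt0 (swapXY P2); rewrite nz2 => s2 s12.
have [sz1|sz2] : size (swapXY P1) = 1%N \/ size (swapXY P2) = 1%N.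
- by move: (size _) (size _) s1 s2 s12 => a b; lia.
- have [q Dq] := size_swap _ sz1; exfalso.
  have szq : size q = 1%N by apply: (dvd1 _ (swapXY P2)); rewrite Es Dq swapXY_map_polyC.
  have := DP1; rewrite Dq => /(congr1 (size (T := L) \o (@polyseq L))) /=.
  rewrite (size_map_inj_poly (@polyL_inj F L)) ?rmorph0 //.
  rewrite (size_map_inj_poly (@polyC_inj _)) ?rmorph0 // szq.
  rewrite -big_enum /= size_prod_XsubC -cardE => -[] /eqP.
  by rewrite eq_sym cards_eq0 => /eqP O0; rewrite O0 inE in iO.
- have [q Dq] := size_swap _ sz2.
  have szq : size q = 1%N.
    by apply: (dvd1 _ (swapXY P1)); rewrite Es Dq swapXY_map_polyC mulrC.
  have := DP2; rewrite Dq => /(congr1 (size (T := L) \o (@polyseq L))) /=.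
  rewrite (size_map_inj_poly (@polyL_inj F L)) ?rmorph0 //.
  rewrite (size_map_inj_poly (@polyC_inj _)) ?rmorph0 // szq.
  rewrite -big_enum /= size_prod_XsubC -cardE => -[] /eqP.
  by rewrite eq_sym cards_eq0 => /eqP O0; rewrite -[O]setCK O0 setC0.
Qed.

Lemma rd_g0 : g.[0] = 0.
Proof. by rewrite (rd_double rd) hornerM hornerXn expr0n mul0r. Qed.

Lemma deriv_cover_root i : fL^`().[x i] = \prod_(k | k != i) (x i - x k).
Proof.
rewrite cover_poly_factor (bigD1 i) //= derivM derivB derivX derivC subr0 mul1r.
rewrite hornerD hornerM !hornerE subrr mul0r addr0 horner_prod.
by apply: eq_bigr => k _; rewrite !hornerE.
Qed.

(** Inertia preserves the residues of the roots. Only the residue 0 is shared, and by at most two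
    roots, so a nontrivial inertia element exchanges these two. The list [zs] brings further
    elements into the domain of the place. *)
Lemma inertia_tperm (zs : seq L) :
    (forall z, z \in zs -> integralOver (@polyL F L) z) ->
  exists kappa iota A lam, exists (s : gal_of {:L}) (a b : 'I_m),
    [/\ @is_place F L kappa iota A lam, forall z, z \in zs -> A z,
        forall z, A z -> lam (s z) = lam z, a != b & gal_perm s = tperm a b].
Proof.
move=> int_zs; have [|K [iota [A [lam [pl Azs]]]]] := @place_exists F L cover_galois (rs ++ zs).
  by move=> z; rewrite mem_cat => /orP[/cover_root_onto[i ->]|/int_zs //]; apply: integral_cover_root.
have Ax i : A (x i) by apply: Azs; rewrite mem_cat mem_cover_root.
have [A1 AB AM] := place_ring pl; have A0 := place_A0 pl.
have AT : A T by apply: (place_poly pl).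
have lamT : lam T = 0 by rewrite (place_polyE pl) hornerX rmorph0.
pose rho i := lam (x i).
have g_rho i : (map_poly iota g).[rho i] = 0.
  rewrite -(place_horner pl) // -cover_rootE ?root_cover_root // (placeM pl) ?lamT ?mul0r //.
  exact: (place_hornerA pl).
have Xv_rho i : rho i * (map_poly iota v).[rho i] = 0.
  have := g_rho i; rewrite (rd_double rd) rmorphM /= map_polyXn !hornerE => /eqP.
  by rewrite expr2 -mulrA mulf_eq0 => /orP[/eqP->|/eqP //]; rewrite mul0r.
(* A shared residue is a zero of the wronskian, because [WL] at a root is f' times h there. It is
   then not a zero of [v], which is coprime to the wronskian. *)
have rho_inj i k : i != k -> rho i = rho k -> rho i = 0.
  move=> neq_ik eq_ik; have Wi : (map_poly iota (wronskian g h)).[rho i] = 0.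
    rewrite -(place_horner pl) //.
    have := congr1 (fun q : {poly L} => q.[x i]) (wronskian_h 1).
    rewrite !scale1r !hornerE (rootP (root_cover_root i)) mul0r subr0 => <-.
    have Ad k' : A (x i - x k') by apply: AB.
    rewrite deriv_cover_root (placeM pl).
    - rewrite (place_prod pl) // (bigD1 k) 1?eq_sym //= (placeB pl) //.
      by rewrite -/(rho i) eq_ik subrr !mul0r.
    - exact: (subring_prod (place_ring pl)).
    - exact: (place_hornerA pl).
  have := Xv_rho i => /eqP; rewrite mulf_eq0 => /orP[/eqP //|vi].
  have : coprimep (map_poly iota v) (map_poly iota (wronskian g h)).
    by rewrite coprimep_map (rd_coprime_wronskian rd).
  by move/coprimep_root/(_ vi); rewrite Wi eqxx.
pose J := [set i | rho i == 0].
have [i0 J0] : exists i, rho i = 0.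
  have : lam fL.[0] = 0.
    rewrite cover_polyE !hornerE (placeB pl).
    - rewrite (placeM pl) ?lamT ?mul0r ?subr0 //; last exact: (place_hornerA pl).
      by rewrite (place_horner pl) // (place0 pl) -(rmorph0 iota) horner_map rd_g0.
    - exact: (place_hornerA pl).
    - by apply: AM => //; apply: (place_hornerA pl).
  rewrite cover_poly_factor horner_prod (place_prod pl) => [|i _]; last by rewrite !hornerE -sub0r; apply: AB.
  move/eqP/prodf_eq0=> [i _]; rewrite hornerXsubC (placeB pl) // (place0 pl).
  by rewrite sub0r oppr_eq0 => /eqP; exists i.
(* Three roots with residue 0 would make the coefficient of X^2 in f reduce to 0, but it reduces to
   [v.[0]]. *)
have cardJ : (#|J| <= 2)%N.
  rewrite leqNgt; apply/negP=> J3.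
  pose M z := A z /\ lam z = 0.
  have idM : is_ideal A M.
    split; first by split=> //; apply: (place0 pl).
      by move=> y z [Ay y0] [Az z0]; split; [apply: AB | rewrite (placeB pl) // y0 z0 subr0].
    by move=> y z Ay [Az z0]; split; [apply: AM | rewrite (placeM pl) // z0 mulr0].
  have idA := subring_ideal (place_ring pl).
  pose D := \prod_(k in J) ('X - (x k)%:P).
  pose Q := \prod_(k | k \notin J) ('X - (x k)%:P).
  have AQ : coefs_in A Q by apply: (coefs_in_prod_XsubC (place_ring pl)).
  have [_ MD] : coefs_in A D /\ coefs_in M (D - 'X ^+ #|J|).
    rewrite /D -prodr_const; elim/big_rec2: _ => [|k q2 q1 Jk [O1 M12]].
      by rewrite subrr; split; [apply: (coefs_inC idA) | apply: (coefs_in0 idM)].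
    have AX : coefs_in A ('X - (x k)%:P).
      have := @coefs_in_prod_XsubC _ A (place_ring pl) _ [:: k] xpredT x (fun i _ => Ax i).
      by rewrite big_seq1.
    split; first exact: (coefs_inM idA).
    have -> : ('X - (x k)%:P) * q1 - 'X * q2 =
        ('X - (x k)%:P) * (q1 - q2) - q2 * (x k)%:P by ring.
    apply: (coefs_inB idM); first exact: (coefs_inM idM).
    apply: (coefs_inM idM).
      have -> : q2 = q1 - (q1 - q2) by ring.
      by apply: (coefs_inB idA) => // l; case: (M12 l).
    by apply: (coefs_inC idM); split=> //; move: Jk; rewrite inE => /eqP.
  have Df : fL = Q * D by rewrite cover_poly_factor (bigID (mem J)) /= mulrC.
  have [_] : M fL`_2.
    have : M (Q * (D - 'X^#|J|))`_2 by apply: (coefs_inM idM).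
    by rewrite mulrBr coefB coefMXn J3 subr0 -Df.
  rewrite cover_polyE coefB coefZ !coef_map /= (placeB pl) ?(placeM pl) ?lamT ?mul0r ?subr0 //;
    try exact: (place_poly pl).
    rewrite (place_constF pl) (rd_double rd) coefXnM /= -horner_coef0 => /eqP.
    by rewrite fmorph_eq0 (negPf (rd_v0 rd)).
  by apply: AM => //; apply: (place_poly pl).
have [s [Gs s1 lam_s]] : exists s, [/\ s \in G, s != 1%g & forall z, A z -> lam (s z) = lam z].
  (* At a root x one has t h(x) = g(x) = x * (x v(x)). All conjugates of the second factor reduce to
     0, since every residue of a root is a zero of X v. *)
  apply: (inertia_exists cover_galois pl (x := x i0) (y := x i0 * (map_poly cL v).[x i0])
    (h := hL.[x i0])) => //.
  - by apply: AM => //; apply: (place_hornerA pl).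
  - exact: (place_hornerA pl).
  - rewrite cover_rootE ?root_cover_root // (rd_double rd) rmorphM /= map_polyXn hornerM hornerXn.
    by rewrite expr2 mulrA.
  - rewrite (place_horner pl) // -/(rho i0) J0 -(rmorph0 iota) horner_map.
    by rewrite (inj_eq (fmorph_inj iota)) (rd_h0 rd).
  - move=> s Gs; rewrite rmorphM /= -horner_map /= -cover_root_gal_perm.
    have -> : map_poly s (map_poly cL v) = map_poly cL v.
      by apply/polyP=> l; rewrite !coef_map /= gal_polyL.
    rewrite (placeM pl) ?(place_horner pl) ?Xv_rho //.
    exact: (place_hornerA pl).
have rho_s i : rho (gal_perm s i) = rho i by rewrite /rho cover_root_gal_perm lam_s.
have fixJ i : i \notin J -> gal_perm s i = i.
  rewrite inE => nJi; apply/eqP; apply: contraNT nJi => neq_i.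
  by apply/eqP/(rho_inj _ (gal_perm s i)); rewrite 1?eq_sym ?rho_s.
have [a neq_a] : exists a, gal_perm s a != a.
  apply/existsP; apply: contraNT s1; rewrite negb_exists => /forallP fix_s.
  rewrite -gal_perm_eq1; apply/eqP/permP=> i; rewrite perm1.
  by apply/eqP; rewrite -[_ == _]negbK.
pose b := gal_perm s a; have neq_ab : a != b by rewrite eq_sym.
have Ja : a \in J by apply: contraNT neq_a => /fixJ->.
have Jb : b \in J by move: Ja; rewrite !inE rho_s.
have J2 i : i \in J -> i = a \/ i = b.
  move=> Ji; apply/pred2P; apply: contraTT cardJ; rewrite negb_or -ltnNge => /andP[na nb].
  apply/card_gt2P; exists a, b, i; split; first by split.
  by split; rewrite // eq_sym.
exists K, iota, A, lam, s, a, b; split=> // [z zs_z|]; first by apply: Azs; rewrite mem_cat zs_z orbT.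
apply/permP=> i; case: tpermP => [->//|->|/eqP na /eqP nb]; last first.
  by apply: fixJ; apply/negP=> /J2[] Di; move: na nb; rewrite Di eqxx.
have Jsb : gal_perm s b \in J by rewrite inE rho_s; move: Jb; rewrite inE.
case: (J2 _ Jsb) => // sbb; have /perm_inj ba : gal_perm s b = gal_perm s a by rewrite sbb.
by rewrite ba eqxx in neq_ab.
Qed.

Hypothesis pr_m : prime m.

Lemma gal_perm_onto t : exists s, gal_perm s = t.
Proof.
have [//|K [iota [A [lam [s [a [b [_ _ _ neq_ab Ds]]]]]]]] := @inertia_tperm [::].
have /setP/(_ t) : (gal_perm_morphism @* setT)%g = setT.
  apply: (transitive_tperm_full (a := a) (b := b)) => //.
  - by rewrite card_ord.
  - move=> i j; have [u Du] := gal_perm_transitive i j; exists (gal_perm u) => //.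
    by apply/morphimP; exists u; rewrite ?inE.
  - by apply/morphimP; exists s; rewrite ?inE.
by rewrite inE => /morphimP[u _ _ ->]; exists u.
Qed.

Lemma mem_gal_adjoin (s : gal_of {:L}) y : (s \in 'Gal({:L} / <<1; y>>)%g) = (s y == y).
Proof.
rewrite -sub1set galois_connection ?subvf //; apply/FadjoinP/eqP => [[_]|sy].
  by case/mem_fixedFieldP=> _; apply; rewrite inE.
split; first exact: sub1v.
by apply/fixedFieldP=> [|u]; [apply: memvf | rewrite inE => /eqP->].
Qed.

(* Inertia acts trivially on constants, and the transpositions generate. *)
Lemma algebraic_const y : algebraicOver cL y -> exists c, y = constF L c.
Proof.
move=> alg_y; apply: constant_mem1 => //; apply: (gal_fixed_mem1 cover_galois) => u _.
have [z|K [iota [A [lam [s [a [b [pl Ay lam_s neq_ab Ds]]]]]]]] := @inertia_tperm [:: y].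
  by rewrite inE => /eqP->; apply: integral_const_poly.
have {}Ay : A y by apply: Ay; rewrite inE.
have alg_gal (r : gal_of {:L}) z : algebraicOver cL z -> algebraicOver cL (r z).
  case=> q nzq qz; exists q => //.
  have <- : map_poly r (map_poly cL q) = map_poly cL q.
    by apply/polyP=> l; rewrite !coef_map /= gal_polyL ?mem_gal.
  exact: rmorph_root.
have fix_s (r : gal_of {:L}) : s (r y) = r y.
  have Ar : A (r y) by apply: (place_gal pl) => //; apply: mem_gal.
  have Asr : A (s (r y)) by apply: (place_gal pl) => //; apply: mem_gal.
  pose d := s (r y) - r y; apply/eqP; rewrite -subr_eq0 -/d; apply/negPn/negP=> nzd.
  have Ad : A d by case: (place_ring pl) => _ AB _; apply: AB.
  have lamd : lam d = 0 by rewrite (placeB pl) // lam_s // subrr.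
  have [q nzq qd] : algebraicOver cL d by
    exact: (algebraic_sub (alg_gal s _ (alg_gal r _ alg_y)) (alg_gal r _ alg_y)).
  (* Removing the powers of X from an equation of [d] over F leaves [q1], which vanishes at [d] but
     not at 0; this contradicts [lam d = 0]. *)
  have [e [q1]] := multiplicity_XsubC q 0; rewrite nzq /= => q10 Dq.
  move: qd; rewrite Dq rmorphM rmorphXn /= subr0 map_polyX /root !hornerE.
  rewrite mulf_eq0 expf_eq0 (negPf nzd) andbF orbF => /eqP q1d.
  have := place_horner pl q1 Ad; rewrite q1d (place0 pl) lamd -(rmorph0 iota) horner_map.
  by move/esym/fmorph_inj/eqP; rewrite -/(root q1 0) (negPf q10).
(* As [s] fixes every conjugate of [y], every conjugate of [s] fixes [y]. *)
have /setP/(_ (gal_perm u)) : (gal_perm_morphism @* 'Gal({:L} / <<1; y>>))%g = setT.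
  apply: (normal_tperm_full neq_ab) => t; have [r <-] := gal_perm_onto t.
  rewrite -Ds; apply/morphimP; exists (s ^ r)%g; rewrite ?inE //.
    rewrite mem_gal_adjoin conjgE !galM ?memvf // fix_s -galM ?memvf //.
    by rewrite mulVg gal_id.
  by rewrite morphJ ?inE.
rewrite inE => /morphimP[r _ +]; rewrite mem_gal_adjoin => /eqP ry /gal_perm_inj ->.
by [].
Qed.

(** * Values taken on the fixed field of a group that moves many roots *)

Section Unramified.

Variable w : L -> int.
Hypothesis wM : forall y z : L, y != 0 -> z != 0 -> w (y * z) = w y + w z.
Hypothesis wD : forall y z : L, y != 0 -> z != 0 -> y + z != 0 ->
  Num.min (w y) (w z) <= w (y + z).
Hypothesis wC : forall c : F, c != 0 -> w (constF L c) = 0.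

Local Notation O := (vint w).
Local Notation M := (vmax w).
Let ringO : is_subring O := vint_ring wM wD.
Let idO : is_ideal O O := subring_ideal ringO.
Let idM : is_ideal O M := vmax_ideal wM wD.

Lemma vint_const c : O (cL c).
Proof.
have [->|nzc] := eqVneq c 0; first by rewrite rmorph0 /vint eqxx.
by rewrite /vint wC // lexx orbT.
Qed.

Lemma Nvmax_const c : c != 0 -> ~~ M (cL c).
Proof. by move=> nzc; rewrite /vmax fmorph_eq0 (negPf nzc) wC. Qed.

Lemma coefs_vint_const (q : {poly F}) : coefs_in O (map_poly cL q).
Proof. by move=> i; rewrite coef_map; apply: vint_const. Qed.

(* At t = oo the cover is given by the multiple f / t of its equation. *)
Lemma local_equation : exists a y d,
  [/\ a != 0 /\ a \in 1%VS, coefs_in O (a *: fL), coefs_in O y,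
      WL = (a *: fL)^`() * y - (a *: fL) * y^`()
    & ~~ M (a *: fL)`_d /\ (m <= d + (p ^ 2 + p))%N].
Proof.
have nzT : T != 0 by rewrite polyL_eq0 polyX_eq0.
have [OT|nOT] := boolP (O T).
  exists 1, hL, m; rewrite !scale1r; split.
  - by rewrite oner_eq0 mem1v.
  - rewrite cover_polyE; apply: (coefs_inB idO); first exact: coefs_vint_const.
    rewrite -mul_polyC; apply: (coefs_inM idO); last exact: coefs_vint_const.
    exact: (coefs_inC idO).
  - exact: coefs_vint_const.
  - by have := wronskian_h 1; rewrite !scale1r.
  - rewrite leq_addr; split=> //; rewrite coef_map /=.
    have := monicP monic_cover; rewrite lead_coefE size_cover /= => ->.
    by rewrite rmorph1 (Nvmax1 wM).
have MT := vmax_inv wM nOT; have OV := vmax_vint MT.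
have DP : T^-1 *: fL = T^-1 *: gL - hL.
  by rewrite cover_polyE scalerBr scalerA mulVf // scale1r.
(* Modulo [M] the equation f / t is -h, whose coefficient at deg h is a unit; [rd_gap] bounds m -
   deg h. *)
exists T^-1, gL, (size h).-1; split.
- by rewrite invr_eq0 nzT rpredV polyL_mem1.
- rewrite DP; apply: (coefs_inB idO); last exact: coefs_vint_const.
  rewrite -mul_polyC; apply: (coefs_inM idO); last exact: coefs_vint_const.
  exact: (coefs_inC idO).
- exact: coefs_vint_const.
- by rewrite wronskian_g mulVf // scale1r.
- have nzh : h != 0 by apply: contraNneq (rd_h0 rd) => ->; rewrite horner0.
  have szh : (0 < size h)%N by rewrite size_poly_gt0.
  have gap := rd_gap rd; split; last by clear -szh gap; lia.
  rewrite DP coefB coefZ !coef_map /= -lead_coefE.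
  apply/negP=> MP; have : M (cL (lead_coef h)).
    have -> : cL (lead_coef h) =
        T^-1 * cL g`_(size h).-1 - (T^-1 * cL g`_(size h).-1 - cL (lead_coef h)) by ring.
    case: (idM) => _ MB MM; apply: MB => //; rewrite mulrC; apply: MM => //.
    exact: vint_const.
  by apply/negP/Nvmax_const; rewrite lead_coef_eq0.
Qed.

(** At a root, [WL] is the derivative of the local equation times an integral element, so a unit
    value forces simplicity. Unlike the local equation, [WL] does not depend on the place. *)
Let good i := O (x i) && ~~ M WL.[x i].

(** At most [p ^ 2 + p] roots are not integral, and at most p (p + 1) integral ones are zeros of
    [WL] modulo [M]. *)
Lemma card_bad : (#|[set i | ~~ good i]| <= 2 * (p ^ 2 + p))%N.
Proof.
have [a [y [d [_ OP Oy DW [nMd led]]]]] := local_equation.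
have OW : coefs_in O WL by apply: coefs_vint_const.
have nMW : ~ coefs_in M WL.
  move/(_ (size (wronskian g h)).-1); rewrite coef_map /= -lead_coefE.
  by apply/negP/Nvmax_const; rewrite lead_coef_eq0 (rd_wronskian rd).
rewrite cover_poly_factor in OP nMd DW.
have leO := card_Nvint_roots wM wD OP nMd; rewrite card_ord in leO.
have leW := card_ramified_roots wM wD OP Oy OW nMW DW.
have szW : (size WL <= p.+1)%N by rewrite size_map_poly (rd_size_wronskian rd).
have leWp : ((size WL).-1 * size WL <= p * p.+1)%N.
  by rewrite leq_mul // -subn1 leq_subLR add1n.
have sub : [set i | ~~ good i] \subset
    [set i | ~~ O (x i)] :|: [set i | O (x i) && M WL.[x i]].
  by apply/subsetP=> i; rewrite !inE /good negb_and negbK; case: (O (x i)).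
have leS := leq_trans (subset_leq_card sub) (leq_card_setU _ _).
have pp : (p * p.+1 = p ^ 2 + p)%N by rewrite mulnS -mulnn addnC.
rewrite pp in leWp; have leB := leq_trans leW leWp.
have leA : (#|[set i | ~~ O (x i)]| <= p ^ 2 + p)%N.
  by rewrite -(leq_add2r d) (leq_trans leO) // addnC.
by apply: leq_trans leS _; rewrite mul2n -addnn leq_add.
Qed.

Lemma good_simple (E : {subfield L}) i : good i ->
  O (x i) /\ exists P, [/\ coefs_in (fun b => b \in E /\ O b) P, P.[x i] = 0
    & ~~ M P^`().[x i]].
Proof.
case/andP=> Oi nMi; split=> //.
have [a [y [d [[nza a1] OP Oy DW _]]]] := local_equation.
have fi := rootP (root_cover_root i).
exists (a *: fL); split=> [k||].
- split; last exact: OP.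
  by rewrite coefZ coef_map (subvP (sub1v E)) // rpredM // polyL_mem1.
- by rewrite hornerZ fi mulr0.
apply: contra nMi => MP; rewrite DW hornerD hornerN !hornerM hornerZ fi mulr0 mul0r subr0.
rewrite mulrC; case: idM => _ _; apply=> //.
exact: (coefs_in_horner ringO idO).
Qed.

Lemma value_of_moving_group (H : {group gal_of {:L}}) :
    (forall s, s \in H -> s != 1%g ->
       (2 * (p ^ 2 + p) < #|[set i | gal_perm s i != i]|)%N) ->
  forall y, y != 0 -> exists a, [/\ a \in fixedField H, a != 0 & w a = w y].
Proof.
move=> moveH y nzy; pose zs := [seq x i | i <- enum good].
apply: (value_adjoin_seq wM wD (zs := zs)) => //.
  by move=> z /mapP[i]; rewrite mem_enum => good_i ->; apply: good_simple.
have gal_adjoin : galois <<fixedField H & zs>>%AS {:L}.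
  apply: galoisS (fixedField_galois H); rewrite subvf andbT.
  exact: subv_adjoin_seq.
have /galois_fixedField/= <- := gal_adjoin; apply/fixedFieldP=> [|s]; first exact: memvf.
rewrite -sub1set galois_connection ?subvf // => /Fadjoin_seqP[fixH fix_zs].
suff -> : s = 1%g by rewrite gal_id.
have Hs : s \in H.
  by rewrite -(gal_fixedField H) -sub1set galois_connection ?subvf.
apply/eqP/negPn/negP=> /(moveH s Hs); apply/negP; rewrite -leqNgt.
apply: leq_trans card_bad; apply/subset_leq_card/subsetP=> i; rewrite !inE.
apply: contra => good_i; apply/eqP/cover_root_inj; rewrite cover_root_gal_perm.
have /fix_zs/mem_fixedFieldP[_] : x i \in zs.
  by apply/mapP; exists i; rewrite ?mem_enum.
by apply; rewrite inE.
Qed.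

End Unramified.

End TheCover.

Lemma cover_splits (F : fieldType) (p m : nat) (g h v : {poly F}) :
    ramification_data p m g h v ->
  exists (L : splittingFieldType (ratfun F)) (rs : seq L),
    map_poly (@polyL F L) (cover_poly g h) = \prod_(z <- rs) ('X - z%:P)
    /\ <<1 & rs>>%VS = {:L}%VS.
Proof.
move=> rd; pose f0 := map_poly (@FracField.tofrac {poly F}) (cover_poly g h).
have monf0 : f0 \is monic by rewrite monic_map // (monic_cover rd).
have [L [rs Drs genL]] := splitting_field_exists (monic_neq0 monf0).
exists L, rs; split=> //; apply/eqP; rewrite -eqp_monic ?monic_prod_XsubC //.
  by rewrite -map_poly_comp in Drs.
by rewrite monic_map // (monic_cover rd).
Qed.

Theorem theorem3 (p : nat) (F : finFieldType) (n : nat) :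
  prime p -> p \in [pchar F] -> (5 <= n)%N ->
  exists (L : splittingFieldType (ratfun F)) (k K : {subfield L}),
    [/\ constant_field_is_F k,
        constant_field_is_F K,
        galois k K,
        unramified k K
      & ('Gal(K / k) \isog [set: 'S_n])%g].
Proof.
(* One more than the bound of [card_bad]. *)
move=> pr_p charFp _; pose r := (2 * (p ^ 2 + p)).+1.
(* The first term makes room for [r] copies of the natural action, the second for
   [ramification_data_exists]. *)
have [m lt_m pr_m] := prime_above (n * r + 3 * p ^ 2).
have le_m : (n * r <= m)%N by lia.
have le_m3 : (3 * p ^ 2 <= m)%N by lia.
have [g [h [v rd]]] := ramification_data_exists pr_p charFp pr_m le_m3.
have [L [rs [Drs genL]]] := cover_splits rd.
pose gp := gal_perm_morphism rd Drs.
pose dg := @Morphism _ _ [set: 'S_n] (@diag_perm n r m le_m) (in2W (@diag_permM n r m le_m)).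
pose H := (gp @*^-1 (dg @* setT))%G.
have gp_inj : ('injm gp)%g by apply/injmP=> s t _ _; apply: gal_perm_inj.
have moves t : t != 1%g -> (r <= #|[set i | dg t i != i]|)%N.
  exact: diag_perm_moves.
have dg_inj : ('injm dg)%g.
  apply/subsetP=> t /morphpreP[_ /set1P dt1]; rewrite inE.
  apply/negPn/negP=> /moves; rewrite (_ : [set i | _] = set0) ?cards0 //.
  by apply/setP=> i; rewrite !inE dt1 perm1 eqxx.
have constL (E : {vspace L}) : constant_field_is_F E.
  move=> y _ [q [nzq qy]]; apply: (algebraic_const rd Drs genL pr_m).
  by exists q.
exists L, (fixedField_aspace H), {:L}%AS; split=> //.
- exact: fixedField_galois.
- move=> w [wM wD [t0 _ /andP[nzt0 /eqP wt0]] wC].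
  have wM' (y z : L) : y != 0 -> z != 0 -> w (y * z) = w y + w z.
    by move=> ? ?; apply: wM; rewrite ?memvf.
  have wD' (y z : L) : y != 0 -> z != 0 -> y + z != 0 ->
      Num.min (w y) (w z) <= w (y + z).
    by move=> ? ? ?; apply: wD; rewrite ?memvf.
  (* An element of k with the value of the uniformizer [t0] witnesses ramification index 1. *)
  have [|a [Ea nza wa]] := 
    @value_of_moving_group _ _ _ _ _ _ rd L rs Drs w wM' wD' wC H _ t0 nzt0.
    move=> s /morphpreP[_ /morphimP[t _ _ Ds]] s1.
    have -> : gal_perm rd Drs s = dg t by rewrite -Ds.
    apply: moves; apply: contraNneq s1 => t1; rewrite -(gal_perm_eq1 rd Drs genL).
    by apply/eqP; rewrite -[gal_perm _ _ _]/(gp s) Ds t1 morph1.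
  by exists a => //; rewrite nza wa wt0 eqxx.
- rewrite gal_fixedField isog_sym.
  have DgH : (gp @* H)%g = (dg @* setT)%g.
    rewrite morphpreK //; apply/subsetP=> t _; have [s <-] := gal_perm_onto rd Drs genL pr_m t.
    by apply/morphimP; exists s; rewrite ?inE.
  apply: isog_trans (sub_isog _ dg_inj) _; first exact: subsetT.
  suff : (gp @* H \isog H)%g by rewrite DgH.
  by rewrite isog_sym; apply: (sub_isog _ gp_inj); apply: subsetT.
Qed.
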